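(* Let $q\in(1,2]$ and let $\mathcal{G}:L^q(\Omega)\to[0,\infty]$ be the generative prior (defined in the context) with $L\ge 2$ layers. Assume additionally that, for each $l=1,\dots,L-1$, the functional $\mathcal{J}_l:M^l\to[0,\infty]$ is such that $\mathcal{J}_l(\mu)<\infty$ implies $\mu\in L^2(\Omega^l)^{N_l}$. Then, for every $v\in L^q(\Omega)$ with $\mathcal{G}(v)<\infty$, it holds that $v\in C(\overline{\Omega})$ (i.e. $v$ agrees a.e. with a continuous function on $\overline\Omega$).
   Context: Domains and measures. $\Omega,\Sigma\subset\mathbb{R}^d$ are bounded domains, i.e. bounded, open and simply connected sets, with $0\in\Sigma$. For sets, $A-B=\{x-y: x\in A,\ y\in B\}$. Put $\Omega^0=\Omega$, $\Omega^1=\Omega-\Sigma$ and $\Omega^{l+1}=\Omega^l-\Sigma$. For $\omega\subset\mathbb{R}^d$, $C_0(\omega)$ is the closure of $C_c(\omega)$ in the uniform norm, and $(\mathcal{M}(\omega),\|\cdot\|_{\mathcal M})$ is its dual space (finite Radon measures with the total variation norm). For bounded $\omega$, a function $f\in L^q(\omega)$ is identified with the element $\phi\mapsto\int_\omega f\phi\,dx$ of $\mathcal{M}(\omega)$; $\|\cdot\|_2$ is the $L^2$-norm. Convolution. For $l\ge1$, $\mu\in\mathcal{M}(\Omega^l)$ and $g\in L^2(\Sigma)$, $\mu*g$ denotes the unique function, belonging to $L^q(\Omega^{l-1})$ for every $q\in(1,2]$, with $\int_{\Omega^{l-1}}(\mu*g)\phi\,dx=\int_{\Omega^l}\int_\Sigma\tilde\phi(x+y)g(x)\,dx\,d\mu(y)$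 for all $\phi\in C_c(\Omega^{l-1})$, where $\tilde\phi$ is the extension of $\phi$ by zero to $\mathbb{R}^d$. (It is known that such a function exists and that $\|\mu*g\|_q\le C\|\mu\|_{\mathcal M}\|g\|_2$ with a constant $C$ independent of $\mu,g$.) Network. Let $L\in\mathbb{N}$ be the number of layers, $N_1,\dots,N_L\in\mathbb{N}$ and $N_0=1$. For $l=1,\dots,L$ let $E^l\subset\{1,\dots,N_l\}\times\{1,\dots,N_{l-1}\}$ be such that for each $n\in\{1,\dots,N_l\}$ there is some $k$ with $(n,k)\in E^l$. Set $M^l=\mathcal{M}(\Omega^l)^{N_l}$, $M=M^1\times\dots\times M^L$, $\Theta^l=L^2(\Sigma)^{|E^l|}$ with elements $\theta^l=(\theta^l_{n,k})_{(n,k)\in E^l}$, and $\Theta=\Theta^1\times\dots\times\Theta^L$. Define $\mu^1*_1\theta^1=\sum_{n=1}^{N_1}\mu^1_n*\theta^1_{n,1}\in L^q(\Omega)$ and, for $l=2,\dots,L$, $\mu^l*_l\theta^l=\big(\sum_{n:(n,k)\in E^l}\mu^l_n*\theta^l_{n,k}\big)_{k=1}^{N_{l-1}}\in M^{l-1}$. Generative prior. Let $Z:\Theta\to\mathbb{R}^{N_c}$ ($N_c\in\mathbb{N}$) be linear and bounded and, for $l=1,\dots,L-1$, let $\mathcal{J}_l:M^l\to[0,\infty]$ be weak* lower semicontinuous with $\mathcal{J}_l(0)=0$. Put $\|\mu\|_{\mathcal M}=\sum_{l=1}^L\sum_{n=1}^{N_l}\|\mu^l_n\|_{\mathcal M}$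 and $G(\mu,\theta)=\|\mu\|_{\mathcal M}+\sum_{l=2}^L\mathcal{J}_{l-1}(\mu^{l-1}-\mu^l*_l\theta^l)$. For $v\in L^q(\Omega)$ let $F(v)$ be the set of all $(\mu,\theta)\in M\times\Theta$ with $v=\mu^1*_1\theta^1$, $\|\theta^l_{n,k}\|_2\le1$ for all $l$ and all $(n,k)\in E^l$, and $Z\theta=0$. Then $\mathcal{G}(v)=\inf_{(\mu,\theta)\in F(v)}G(\mu,\theta)$, with $\mathcal{G}(v)=\infty$ if $F(v)=\emptyset$. *)

(* Defs.v *)
From HB Require Import structures.
From mathcomp Require Import all_boot all_order all_algebra.
From mathcomp Require Import all_classical all_reals all_analysis.
From mathcomp Require Import measurable_realfun ring.

Set Implicit Arguments.
Unset Strict Implicit.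
Unset Printing Implicit Defensive.
Import Order.TTheory GRing.Theory Num.Theory.
Import numFieldNormedType.Exports.

Local Open Scope classical_set_scope.
Local Open Scope ring_scope.

Definition borel_rV_display : measure_display.
Proof. exact: default_measure_display. Qed.

Section borel_rV.
Context (R : realType) (d : nat).

Let borel0 : <<s @open 'rV[R]_d >> set0.
Proof. exact: sigma_algebra0. Qed.

Let borelC (A : set 'rV[R]_d) :
  <<s @open 'rV[R]_d >> A -> <<s @open 'rV[R]_d >> (~` A).
Proof. exact: sigma_algebraC. Qed.

Let borel_bigcup (F : (set 'rV[R]_d)^nat) :
  (forall i, <<s @open 'rV[R]_d >> (F i)) ->
  <<s @open 'rV[R]_d >> (\bigcup_i F i).
Proof. exact: sigma_algebra_bigcup. Qed.

HB.instance Definition _ := @isMeasurable.Build borel_rV_display 'rV[R]_d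
  <<s @open 'rV[R]_d >> borel0 borelC borel_bigcup.

Lemma open_measurable_rV (A : set 'rV[R]_d) : open A -> measurable A.
Proof. by move=> oA; exact: sub_sigma_algebra. Qed.

End borel_rV.

Definition cons_rV (R : realType) (d : nat) (p : 'rV[R]_d * R) : 'rV[R]_d.+1 :=
  row_mx (p.2%:M : 'M[R]_1) p.1.


Lemma cons_rV0 (R : realType) (d : nat) (p : 'rV[R]_d * R) :
  cons_rV p ord0 ord0 = p.2.
Proof.
rewrite /cons_rV /= mxE; case: splitP => [j _|k /= /eqP//].
by rewrite mxE !ord1 eqxx mulr1n.
Qed.

Lemma cons_rV_lift (R : realType) (d : nat) (p : 'rV[R]_d * R) (j : 'I_d) :
  cons_rV p ord0 (lift ord0 j) = p.1 ord0 j.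
Proof.
rewrite /cons_rV /= mxE; case: splitP => [k /=|k]; first by rewrite ord1.
by rewrite /= /bump /= => -[] /val_inj <-.
Qed.

Lemma cons_rV_ball (R : realType) (d : nat) (c : 'rV[R]_d.+1) (e : R) :
  0 < e ->
  @cons_rV R d @^-1` ball c e =
  ball (\row_j c ord0 (lift ord0 j)) e `*` ball (c ord0 ord0) e.
Proof.
move=> e0; apply/seteqP; split => [[v x]|[v x]] /=.
- move=> [_ B]; split; last by have := B ord0 ord0; rewrite cons_rV0.
  by split => // i j; rewrite (ord1 i) mxE; have := B ord0 (lift ord0 j); rewrite cons_rV_lift.
- move=> [[_ Bv] Bx]; split => // i j; rewrite (ord1 i).
  case: (unliftP ord0 j) => [k|] ->; last by rewrite cons_rV0.
  by rewrite cons_rV_lift; have := Bv ord0 k; rewrite mxE.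
Qed.

Lemma measurable_cons_rV (R : realType) (d : nat) :
  measurable_fun [set: 'rV[R]_d * R] (@cons_rV R d).
Proof.
apply: (measurability (@open 'rV[R]_d.+1)) => //.
move=> _ [U oU <-]; rewrite setTI.
pose B (ck : 'rV[rat]_d.+1 * nat) := ball (map_mx (@ratr R) ck.1) ck.2.+1%:R^-1.
have -> : U = \bigcup_ck (if `[< B ck `<=` U >] then B ck else set0).
  apply/seteqP; split => [x Ux|x [ck _]]; last first.
    by case: asboolP => // BU /BU.
  have /nbhs_ballP[e /= e0 eU] := open_nbhs_nbhs (conj oU Ux).
  have [k ke] : exists k : nat, k.+1%:R^-1 < e / 2.
    exists (Num.truncn (e / 2)^-1).
    by rewrite invf_plt ?posrE ?divr_gt0// real_truncnS_gt// num_real.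
  have /choice[q qP] (j : 'I_d.+1) : exists q : rat,
      `|x ord0 j - ratr q| < k.+1%:R^-1.
    have [|r [+ [q _ qr]]] := @dense_rat R (ball (x ord0 j) k.+1%:R^-1)
      _ (ball_open _ _).
    by exists (x ord0 j); exact: ballxx.
    by rewrite -qr /ball /= => qx; exists q.
  exists (\row_j q j, k) => //.
  have xB : B (\row_j q j, k) x.
    rewrite /B /=; split => // i j; rewrite !ord1 !mxE.
    by rewrite /ball /= distrC.
  case: asboolP => // -[] y [_ By]; apply: eU; split => // i j; rewrite ord1.
  have := By ord0 j; rewrite /ball /= mxE mxE => Byj.
  rewrite [e]splitr -(subrKA (ratr (q j))) (le_lt_trans (ler_normD _ _))//.
  by rewrite ltrD// (lt_trans _ ke).
rewrite preimage_bigcup.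
apply: countable_bigcupT_measurable => [|ck]; first exact: countableP.
case: asboolP => _; last by rewrite preimage_set0.
rewrite cons_rV_ball//; apply: measurableX; last exact: measurable_ball.
by apply: open_measurable_rV; exact: ball_open.
Qed.

Section lebesgue_step.
Context (R : realType) (d : nat) (m : {measure set 'rV[R]_d -> \bar R}).
Local Open Scope ereal_scope.

Definition lebesgue_step : set 'rV[R]_d.+1 -> \bar R :=
  pushforward (m \x @lebesgue_measure R) (@cons_rV R d).

Let step0 : lebesgue_step set0 = 0.
Proof. by rewrite /lebesgue_step /pushforward preimage_set0 measure0. Qed.

Let step_ge0 A : 0 <= lebesgue_step A.
Proof. by rewrite /lebesgue_step /pushforward; exact: measure_ge0. Qed.

Let step_sigma_additive : semi_sigma_additive lebesgue_step.
Proof.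
have mP B : measurable B -> measurable (@cons_rV R d @^-1` B).
  by move=> mB; rewrite -[X in measurable X]setTI; exact: measurable_cons_rV.
move=> F mF tF mUF; rewrite /lebesgue_step /pushforward preimage_bigcup.
apply: measure_semi_sigma_additive => [n||]; first exact: mP.
  apply/trivIsetP => /= i j _ _ ij; rewrite -preimage_setI.
  by move/trivIsetP : tF => /(_ _ _ _ _ ij) ->//; rewrite preimage_set0.
by rewrite -preimage_bigcup; exact: mP.
Qed.

HB.instance Definition _ := isMeasure.Build _ _ _ lebesgue_step
  step0 step_ge0 step_sigma_additive.

End lebesgue_step.

(* Lebesgue measure on R^(d+1) is the image of (Lebesgue on R^d) x (Lebesgue on
   R) under [cons_rV]; [lebesgue_rV_box] below gives its value on boxes. *)
Fixpoint lebesgue_rV (R : realType) (d : nat) :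
    {measure set 'rV[R]_d -> \bar R} :=
  match d with
  | 0 => \d_ (0 : 'rV[R]_0)
  | d'.+1 => lebesgue_step (lebesgue_rV R d')
  end.

Lemma measurable_box_rV (R : realType) (d : nat) (a b : 'I_d -> R) :
  measurable [set x : 'rV[R]_d | forall j, a j <= x ord0 j <= b j].
Proof.
rewrite (_ : mkset _ = \bigcap_(j in [set: 'I_d])
    ((fun x : 'rV[R]_d => x ord0 j) @^-1` `[a j, b j])); last first.
  apply/seteqP; split => [x ax j _|x ax j]; first by rewrite /= in_itv/=.
  by have := ax j I; rewrite /= in_itv/=.
apply: fin_bigcap_measurable => // j _.
rewrite -[X in measurable X]setCK; apply: measurableC; apply: open_measurable_rV.
rewrite openC; apply: closed_comp => [x _|]; last exact: interval_closed.
exact: (@coord_continuous R 1 d ord0 j).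
Qed.

Lemma lebesgue_rV_box (R : realType) (d : nat) (a b : 'I_d -> R) :
  (forall j, a j <= b j) ->
  lebesgue_rV R d [set x | forall j, a j <= x ord0 j <= b j] =
  (\prod_(j < d) (b j - a j))%:E.
Proof.
elim: d a b => [|d IH] a b ab /=.
  by rewrite big_ord0 diracE mem_set//= => -[].
rewrite /lebesgue_step /pushforward.
rewrite [X in (_ \x _)%E X](_ : _ =
   [set x : 'rV[R]_d | forall j : 'I_d, a (lift ord0 j) <= x ord0 j <= b (lift ord0 j)] `*`
   `[a ord0, b ord0]); last first.
  apply/seteqP; split => [[v x]|[v x]] /=.
    move=> abx; split => [j|].
      by have := abx (lift ord0 j); rewrite cons_rV_lift.
    by have := abx ord0; rewrite cons_rV0 in_itv.
  move=> [abv]; rewrite in_itv /= => abx j.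
  by case: (unliftP ord0 j) => [k|] ->; rewrite ?cons_rV_lift// cons_rV0.
rewrite product_measure1E//; last exact: measurable_box_rV.
rewrite IH// big_ord_recl EFinM muleC; congr (_ * _)%E.
rewrite [LHS](lebesgue_measure_itv `[a ord0, b ord0])/= lte_fin; case: ltP => // ba.
by rewrite (_ : a ord0 = b ord0) ?subrr//; apply/eqP; rewrite eq_le ba ab.
Qed.

(* A function on w is represented by its extension by zero to R^d, so that
   membership in [Lp w p], [Cc w] or [C0 w] includes vanishing off w.  The
   extension of phi by zero that occurs in the convolution is then phi itself. *)
Section spaces.
Context {R : realType} {d : nat}.
Local Notation rV := 'rV[R]_d.
Local Notation leb := (lebesgue_rV R d).
Implicit Types (w : set rV) (f g : rV -> R).

Definition vanishes_off w f := forall x, ~ w x -> f x = 0.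

Definition Lp w (p : \bar R) : {pred rV -> R} :=
  [predI Lfun leb p & mem [set f | vanishes_off w f]].

Definition Lnorm2 f : R := fine ('N[leb]_2%:E[EFin \o f])%E.

Lemma Lp_submod_closed w (p : \bar R) : (1 <= p)%E -> submod_closed (Lp w p).
Proof.
move=> p1; have [L0 LZD] := Lfun_submod_closed leb p1.
split; first by rewrite inE/= L0/= inE.
move=> a f g /andP[Lf /set_mem /= f0] /andP[Lg /set_mem /= g0].
apply/andP; split; first exact: LZD.
apply/mem_set => x wx; change (a * f x + g x = 0).
by rewrite f0// g0// mulr0 addr0.
Qed.

(* Functions, not classes modulo a.e. equality: [L2 w] is seminormed by
   [Lnorm2], and a linear map that is bounded for this seminorm is the same as a
   bounded linear map on the quotient. *)
Record L2 w := MkL2 { L2_fun :> rV -> R; L2P : L2_fun \in Lp w 2%:E }.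

Section L2_lmod.
Variable w : set rV.
HB.instance Definition _ := [isSub for @L2_fun w].
HB.instance Definition _ := [Choice of L2 w by <:].
HB.instance Definition _ := GRing.isSubmodClosed.Build R (rV -> R) (Lp w 2%:E)
  (Lp_submod_closed w (lee1n 2)).
HB.instance Definition _ := [SubChoice_isSubLmodule of L2 w by <:].
End L2_lmod.

(* For w open, a function that is continuous on w with compact support in w is
   one whose zero extension is continuous on R^d. *)
Definition Cc w : set (rV -> R) :=
  [set f | continuous f /\
    exists K, [/\ compact K, K `<=` w & vanishes_off K f]].

(* closure of [Cc w] in the uniform norm *)
Definition C0pred w : {pred rV -> R} :=
  mem [set f | forall e : R, 0 < e ->
    exists2 g, Cc w g & forall x, `|f x - g x| <= e].

Lemma Cc_linear w (a : R) f g : Cc w f -> Cc w g -> Cc w (a *: f + g).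
Proof.
move=> [cf [K [cK Kw fK]]] [cg [K' [cK' Kw' gK']]]; split.
  by move=> x; exact: (cvgD (cvgM (cvg_cst a) (cf x)) (cg x)).
exists (K `|` K'); split; [exact: compactU| by rewrite subUset|].
move=> x /not_orP[Kx K'x]; change (a * f x + g x = 0).
by rewrite fK// gK'// mulr0 addr0.
Qed.

Lemma C0_submod_closed w : submod_closed (C0pred w).
Proof.
split.
  apply/mem_set => e e0; exists (cst 0); last first.
    by move=> x; rewrite subrr normr0 ltW.
  split; first exact: cst_continuous.
  by exists set0; split; [exact: compact0|exact: sub0set|].
move=> a f g /set_mem/= Cf /set_mem/= Cg; apply/mem_set => e e0.
have a1 : 0 < `|a| + 1 by rewrite ltr_wpDl.
have e2 : 0 < e / 2 by rewrite divr_gt0.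
have [f' cf' ff'] := Cf _ (divr_gt0 e2 a1).
have [g' cg' gg'] := Cg _ e2.
exists (a *: f' + g'); first exact: Cc_linear.
move=> x; change (`|a * f x + g x - (a * f' x + g' x)| <= e).
rewrite opprD addrACA -mulrBr [e]splitr (le_trans (ler_normD _ _))// lerD//.
rewrite normrM (le_trans (ler_wpM2l _ (ff' x)))// mulrC -mulrA ler_piMr//.
  by rewrite divr_ge0// ltW.
by rewrite mulrC ler_pdivrMr// mul1r lerDl.
Qed.

Record C0 w := MkC0 { C0_fun :> rV -> R; C0P : C0_fun \in C0pred w }.

Section C0_lmod.
Variable w : set rV.
HB.instance Definition _ := [isSub for @C0_fun w].
HB.instance Definition _ := [Choice of C0 w by <:].
HB.instance Definition _ := GRing.isSubmodClosed.Build R (rV -> R) (C0pred w)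
  (C0_submod_closed w).
HB.instance Definition _ := [SubChoice_isSubLmodule of C0 w by <:].
End C0_lmod.

Definition supnorm f : R := sup (range (fun x => `|f x|)).

Definition dualpred w : {pred C0 w -> R} :=
  mem [set mu : C0 w -> R | linear (mu : C0 w -> R^o) /\
    exists C : R, forall phi, `|mu phi| <= C * supnorm phi].

Lemma dual_submod_closed w : submod_closed (@dualpred w).
Proof.
split.
  apply/mem_set; split; first by move=> a u v /=; rewrite scaler0 addr0.
  by exists 0 => phi; rewrite mul0r normr0.
move=> a mu nu /set_mem[/= lmu [C muC]] /set_mem[/= lnu [D nuD]].
apply/mem_set; split => [b u v|].
  change (a * mu (b *: u + v) + nu (b *: u + v) =
          b * (a * mu u + nu u) + (a * mu v + nu v)).
  rewrite lmu lnu /GRing.scale /=; ring.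
exists (`|a| * C + D) => phi; change (`|a * mu phi + nu phi| <=
  (`|a| * C + D) * supnorm phi).
rewrite mulrDl (le_trans (ler_normD _ _))// lerD// normrM -mulrA.
by rewrite ler_wpM2l.
Qed.

(* finite Radon measures on w, as the dual space of C_0(w) *)
Record M w := MkM { M_fun :> C0 w -> R; MP : M_fun \in @dualpred w }.

Section M_lmod.
Variable w : set rV.
HB.instance Definition _ := [isSub for @M_fun w].
HB.instance Definition _ := [Choice of M w by <:].
HB.instance Definition _ := GRing.isSubmodClosed.Build R (C0 w -> R) (@dualpred w)
  (dual_submod_closed w).
HB.instance Definition _ := [SubChoice_isSubLmodule of M w by <:].
End M_lmod.


Definition Mnorm w (mu : M w) : \bar R :=
  ereal_sup [set `|mu phi|%:E | phi in [set phi : C0 w | supnorm phi <= 1]].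

(* The identification of L^q(w) with a subspace of M(w).  The functional is
   linear and bounded as soon as w is open and bounded and f is in L^q(w) with
   q >= 1; the default value 0 of [insubd] is only taken otherwise. *)
Definition M_of_fun w (f : rV -> R) : M w :=
  insubd (0 : M w) (fun phi : C0 w => \int[leb]_(x in w) (f x * phi x)).

Definition setsub (A B : set rV) : set rV := [set x - y | x in A & y in B].

Definition correlation (S : set rV) (g phi : rV -> R) (y : rV) : R :=
  \int[leb]_(x in S) (phi (x + y) * g x).

(* mu is paired with y |-> \int_S phi(x + y) g(x) dx.  For w open and bounded, S
   bounded and phi in C_c(w), this function is continuous on R^d and vanishes off
   the open bounded set w - S, hence lies in C_0(w - S), and [insubd] does not
   return its default value. *)
Definition is_conv (w S : set rV) (mu : M (setsub w S)) (g : L2 S)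
    (f : rV -> R) : Prop :=
  (forall q : R, 1 < q <= 2 -> f \in Lp w q%:E) /\
  forall phi, Cc w phi ->
    \int[leb]_(x in w) (f x * phi x) =
    mu (insubd (0 : C0 (setsub w S)) (correlation S g phi)).

(* A representative of the function mu * g, which exists and is unique up to
   a.e. equality when w and S are bounded domains. *)
Definition conv (w S : set rV) (mu : M (setsub w S)) (g : L2 S) : rV -> R :=
  xget (cst 0) [set f | is_conv mu g f].

(* The weak* topology on M(w)^n is the initial topology for the evaluations
   mu |-> mu_i(phi), i < n, phi in C_0(w). *)
Definition weakstar_lsc n w (J : ('I_n -> M w) -> \bar R) : Prop :=
  @lower_semicontinuous
    (initial_topology
      ((fun mu i => mu i.1 i.2) : ('I_n -> M w) -> {ptws 'I_n * C0 w -> R}))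
    R J.

Definition path_connected (A : set rV) : Prop :=
  forall x y, A x -> A y -> exists gamma : R -> rV,
    [/\ {within `[0, 1], continuous gamma}, gamma 0 = x, gamma 1 = y &
        forall t, 0 <= t <= 1 -> A (gamma t)].

Definition null_homotopic_in (A : set rV) (gamma : R -> rV) : Prop :=
  exists H : R * R -> rV,
    [/\ {within `[0, 1] `*` `[0, 1], continuous H},
        forall s t, 0 <= s <= 1 -> 0 <= t <= 1 -> A (H (s, t)),
        forall t, 0 <= t <= 1 -> H (0, t) = gamma t,
        forall t, 0 <= t <= 1 -> H (1, t) = gamma 0 &
        forall s, 0 <= s <= 1 -> H (s, 0) = gamma 0 /\ H (s, 1) = gamma 0].

Definition simply_connected (A : set rV) : Prop :=
  path_connected A /\
  forall gamma : R -> rV,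
    {within `[0, 1], continuous gamma} ->
    (forall t, 0 <= t <= 1 -> A (gamma t)) -> gamma 0 = gamma 1 ->
    null_homotopic_in A gamma.

Definition bounded_domain (A : set rV) : Prop :=
  [/\ bounded_set A, open A & simply_connected A].

Fixpoint layer (Omega Sigma : set rV) (l : nat) : set rV :=
  if l is l'.+1 then setsub (layer Omega Sigma l') Sigma else Omega.

End spaces.

Definition width (N : nat -> nat) (l : nat) : nat := if l is 0 then 1 else N l.

Section network.
Context {R : realType} {d : nat} (Omega Sigma : set 'rV[R]_d).
Context (L : nat) (N : nat -> nat).
Local Notation leb := (lebesgue_rV R d).

(* The index l : 'I_L stands for the layer l + 1, and i : 'I_L.-1 for the index
   i + 1 of a functional J, in the numbering 1, .., L and 1, .., L - 1. *)
Definition edges := forall l : 'I_L, {set 'I_(width N l.+1) * 'I_(width N l)}.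

Definition edge (E : edges) := {l : 'I_L & {nk | nk \in E l}}.

Definition M_layer (l : nat) := 'I_(width N l) -> M (layer Omega Sigma l).
Definition M_total := forall l : 'I_L, M_layer l.+1.
Definition Theta (E : edges) := edge E -> L2 Sigma.

Definition incoming_ok (E : edges) : Prop :=
  forall (l : 'I_L) (n : 'I_(width N l.+1)), exists k, (n, k) \in E l.

Context (E : edges).

(* k-th component of mu^{l+1} *_{l+1} theta^{l+1} *)
Definition conv_layer (l : 'I_L) (mu : M_layer l.+1) (theta : Theta E)
    (k : 'I_(width N l)) : 'rV[R]_d -> R :=
  \sum_(e : {nk | nk \in E l} | (val e).2 == k)
     conv (w := layer Omega Sigma l) (mu (val e).1) (theta (existT _ l e)).

Definition lower (i : 'I_L.-1) : 'I_L := widen_ord (leq_pred L) i.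

Fact upper_subproof (i : 'I_L.-1) : (i.+1 < L)%N.
Proof. by rewrite -ltn_predRL. Qed.

Definition upper (i : 'I_L.-1) : 'I_L := Ordinal (upper_subproof i).

(* mu^{i+1} - mu^{i+2} *_{i+2} theta^{i+2} *)
Definition residual (mu : M_total) (theta : Theta E) (i : 'I_L.-1) :
    M_layer i.+1 := fun k =>
  mu (lower i) k - M_of_fun (layer Omega Sigma i.+1)
                     (conv_layer (l := upper i) (mu (upper i)) theta k).

Definition energy (J : forall i : 'I_L.-1, M_layer i.+1 -> \bar R)
    (mu : M_total) (theta : Theta E) : \bar R :=
  (\sum_(l < L) \sum_(n < width N l.+1) Mnorm (mu l n) +
   \sum_(i < L.-1) J i (@residual mu theta i))%E.

Definition bounded_param (Nc : nat) (Z : Theta E -> 'rV[R]_Nc) : Prop :=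
  exists C : R, forall theta,
    `|Z theta| <= C * \sum_(e : edge E) Lnorm2 (theta e).

(* The equation v = mu^1 *_1 theta^1 in L^q(Omega) is the instance l = 0, where
   k ranges over the one-element type 'I_(width N 0). *)
Definition feasible (Nc : nat) (Z : Theta E -> 'rV[R]_Nc) (v : 'rV[R]_d -> R) :
    set (M_total * Theta E) :=
  [set mt | [/\
    forall (l : 'I_L) (k : 'I_(width N l)), val l = 0%N ->
      {ae leb, forall x, Omega x -> v x = conv_layer (mt.1 l) mt.2 k x},
    forall e, Lnorm2 (mt.2 e) <= 1 &
    Z mt.2 = 0]].

Definition gen_prior (Nc : nat) (Z : Theta E -> 'rV[R]_Nc)
    (J : forall i : 'I_L.-1, M_layer i.+1 -> \bar R) (v : 'rV[R]_d -> R) :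
    \bar R :=
  ereal_inf [set energy J mt.1 mt.2 | mt in feasible Z v].

End network.

(* Main.v *)
Require Import Defs.
From HB Require Import structures.
From mathcomp Require Import all_boot all_order all_algebra.
From mathcomp Require Import all_classical all_reals all_analysis.
From mathcomp Require Import measurable_realfun finmap ring lra.

Set Implicit Arguments.
Unset Strict Implicit.
Unset Printing Implicit Defensive.
Import Order.TTheory GRing.Theory Num.Theory.
Import numFieldNormedType.Exports.

Local Open Scope classical_set_scope.
Local Open Scope ring_scope.

(** The prior is finite only if some network [(mu, theta)] produces [v] with
finite energy.  The first residual [mu^1 - mu^2 * theta^2] then lies in [L^2], and
so does [mu^2 * theta^2], because the convolution of a measure with an [L^2]
kernel is an [L^q] function up to and including [q = 2].  Hence the first layer
[mu^1] is no longer a genuine measure: each of its components is given by a density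
[h] in [L^2(Omega - Sigma)] ([L2_represented]).  Now [v] is a finite sum of terms
[mu^1_n * theta^1_n], each of which is, almost everywhere on [Omega], an honest
convolution [z |-> \int h(z - x) g(x) dx] of two square-integrable functions
([is_conv_ae_convolution]), and such a convolution is continuous on the whole space
([continuous_convolution]).

The identification of [mu * g] with the honest convolution is by duality: for a
test function [phi] the exchange of integrals and a translation turn the pairing of
[h] with the correlation of [phi] and [g] into the pairing of [phi] with the
convolution of [h] and [g] ([convolution_adjoint]); two square-integrable functions
with the same pairings against all test functions agree almost everywhere
([orthogonal_Cc_ae0]).  This needs the correlation to be a continuous function
with compact support in [Omega - Sigma] ([Cc_correlation]).

Both the continuity of the convolution and the uniqueness by duality rest on the
density of [C_c(W)] in [L^2(W)] for a bounded open set [W] ([Cc_dense_L2]), which is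
obtained from open sets by a Dynkin argument.  The change of variables needs the
invariance of Lebesgue measure under [x |-> x + z] and [x |-> z - x], which holds
because these maps send boxes to boxes of the same volume
([lebesgue_rV_invariant]). *)

(** * Measurability and invariance of Lebesgue measure on R^d *)

Lemma measurable_fun_rV (R : realType) (d : nat) d' (T : measurableType d')
    (f : T -> 'rV[R]_d) :
  (forall j, measurable_fun setT (fun t => f t ord0 j)) ->
  measurable_fun setT f.
Proof.
elim: d f => [|d IH] f mf.
  rewrite (_ : f = cst 0); first exact: measurable_cst.
  by apply/funext => t; exact: thinmx0.
rewrite (_ : f = @cons_rV R d \o
    (fun t => (\row_j f t ord0 (lift ord0 j), f t ord0 ord0))).
  apply: measurableT_comp; first exact: measurable_cons_rV.
  apply: measurable_fun_pair; last exact: mf.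
  by apply: IH => j; under eq_fun do rewrite mxE; exact: mf.
apply/funext => t /=; apply/rowP => j.
case: (unliftP ord0 j) => [k|] ->; last by rewrite cons_rV0.
by rewrite cons_rV_lift mxE.
Qed.

Lemma continuous_measurable_rV (R : realType) (d : nat) (f : 'rV[R]_d -> R) :
  continuous f -> measurable_fun setT f.
Proof.
move=> /continuousP cf; apply: (measurability _ (RGenOpens.measurableE R)).
move=> _ [_ [a [b ->] <-]]; rewrite setTI.
by apply: open_measurable_rV; apply: cf; exact: interval_open.
Qed.

Lemma measurable_coord (R : realType) (d : nat) (j : 'I_d) :
  measurable_fun setT (fun x : 'rV[R]_d => x ord0 j).
Proof.
by apply: continuous_measurable_rV => x; exact: (@coord_continuous R 1 d ord0 j).
Qed.

Lemma le_coord_norm (R : realType) (d : nat) (x : 'rV[R]_d) j :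
  `|x ord0 j| <= `|x|.
Proof.
rewrite [leRHS]mx_normrE; exact: (le_bigmax _ (fun ij => `|x ij.1 ij.2|) (ord0, j)).
Qed.

Section boxes.
Context (R : realType) (d : nat).
Local Notation rV := 'rV[R]_d.

Definition box (a b : 'I_d -> R) : set rV :=
  [set x | forall j, a j <= x ord0 j <= b j].

Definition boxes : set (set rV) :=
  [set A | exists a b, A = box a b].

Lemma setI_closed_boxes : setI_closed boxes.
Proof.
move=> _ _ [a [b ->]] [a' [b' ->]].
exists (fun j => Num.max (a j) (a' j)), (fun j => Num.min (b j) (b' j)).
apply/seteqP; split => x /= => [[xab xab'] j|xab].
  have /andP[? ?] := xab j; have /andP[? ?] := xab' j.
  by rewrite ge_max le_min; apply/andP; split; apply/andP; split.
by split => j; have := xab j; rewrite ge_max le_min => /andP[/andP[? ?] /andP[? ?]];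
  apply/andP; split.
Qed.

Lemma rational_approx (x : R) (e : R) : 0 < e ->
  exists q : rat, `|x - ratr q| < e.
Proof.
move=> e0; have [|r [+ [q _ qr]]] := @dense_rat R (ball x e) _ (ball_open _ _).
  by exists x; exact: ballxx.
by rewrite -qr => ?; exists q.
Qed.

(** Every point of an open set lies in a small closed box with rational centre
contained in the set, so an open set is a countable union of boxes. *)
Lemma measurable_boxesE : @measurable _ rV = <<s boxes >>.
Proof.
apply/seteqP; split; last first.
  apply: smallest_sub; first exact: sigma_algebra_measurable.
  by move=> _ [a [b ->]]; exact: measurable_box_rV.
apply: smallest_sub; first exact: smallest_sigma_algebra.
move=> U oU.
pose B (ck : 'rV[rat]_d * nat) := box (fun j => ratr (ck.1 ord0 j) - ck.2.+1%:R^-1)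
   (fun j => ratr (ck.1 ord0 j) + ck.2.+1%:R^-1).
have -> : U = \bigcup_ck (if `[< B ck `<=` U >] then B ck else set0).
  apply/seteqP; split => [x Ux|x [ck _]]; last first.
    by case: asboolP => // BU /BU.
  have /nbhs_ballP[e /= e0 eU] := open_nbhs_nbhs (conj oU Ux).
  have [k ke] : exists k : nat, k.+1%:R^-1 < e / 2.
    exists (Num.truncn (e / 2)^-1).
    by rewrite invf_plt ?posrE ?divr_gt0// real_truncnS_gt// num_real.
  have k0 : 0 < k.+1%:R^-1 :> R by rewrite invr_gt0.
  have /choice[q qP] (j : 'I_d) := rational_approx (x ord0 j) k0.
  exists (\row_j q j, k) => //.
  have xB : B (\row_j q j, k) x.
    move=> j /=; rewrite mxE; have := qP j; move: (ratr (q j)) (k.+1%:R^-1) => r s.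
    by rewrite ltr_norml => /andP[? ?]; apply/andP; split; lra.
  case: asboolP => // -[] y By; apply: eU; split => // i j.
  have {i}-> : i = ord0 by exact: ord1.
  have := qP j; have := By j; rewrite /= mxE; move: (ratr (q j)) (k.+1%:R^-1) ke => r s se.
  move=> /andP[? ?]; rewrite ltr_norml => /andP[? ?].
  rewrite /ball /= ltr_norml; apply/andP; split; lra.
apply: (@countable_bigcupT_measurable _ (g_sigma_algebraType boxes)) => [|ck].
  exact: countableP.
case: asboolP => _; last exact: sigma_algebra0.
by apply: sub_sigma_algebra; eexists; eexists.
Qed.

Lemma cover_boxes : \bigcup_(n : nat) box (fun=> - n%:R) (fun=> n%:R) = [set: rV].
Proof.
apply/seteqP; split => // x _.
exists (Num.truncn `|x|).+1 => // j.
have : `|x ord0 j| <= (Num.truncn `|x|).+1%:R.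
  rewrite (le_trans _ (ltW (truncnS_gt _)))//.
  exact: le_coord_norm.
by rewrite ler_norml.
Qed.

Lemma lebesgue_box_fin (n : nat) :
  (lebesgue_rV R d (box (fun=> (- n%:R)%R) (fun=> n%:R%R)) < +oo)%E.
Proof. by rewrite lebesgue_rV_box ?ltry// => j; have := ler0n R n; lra. Qed.

Lemma lebesgue_rV_sigma_finite : sigma_finite setT (lebesgue_rV R d).
Proof.
exists (fun n => box (fun=> - n%:R) (fun=> n%:R)); first by rewrite cover_boxes.
move=> n; split; last exact: lebesgue_box_fin.
exact: measurable_box_rV.
Qed.

(** Boxes are stable under intersection and generate the Borel sets, so a measure
that is finite on bounded boxes is determined by its values on boxes. *)
Lemma lebesgue_rV_invariant (T : rV -> rV) (mT : measurable_fun setT T) :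
  (forall a b : 'I_d -> R, exists a' b' : 'I_d -> R,
    T @^-1` box a b = box a' b' /\ forall j, b' j - a' j = b j - a j) ->
  forall A, measurable A -> lebesgue_rV R d (T @^-1` A) = lebesgue_rV R d A.
Proof.
move=> Tbox A mA.
apply/esym; apply: (@measure_unique _ R rV boxes
  (fun n => box (fun=> - n%:R) (fun=> n%:R)) measurable_boxesE setI_closed_boxes _
  cover_boxes (lebesgue_rV R d) (pushforward (lebesgue_rV R d) T)) => //.
- by move=> n; eexists; eexists.
- move=> _ [a [b ->]].
  change (lebesgue_rV R d (box a b) = lebesgue_rV R d (T @^-1` box a b)).
  have [a' [b' [-> ab]]] := Tbox a b.
  have [ale|] := pselect (forall j, a j <= b j).
    rewrite !lebesgue_rV_box//; last first.
      by move=> j; rewrite -subr_ge0 ab subr_ge0.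
    by congr EFin; apply: eq_bigr => j _; rewrite ab.
  move=> /existsNP[j]; move/negP; rewrite -ltNge => baj.
  have baj' : b' j < a' j by rewrite -subr_lt0 ab subr_lt0.
  have box0 (u v : 'I_d -> R) : v j < u j -> box u v = set0.
    move=> vu; apply/seteqP; split => // x /(_ j) /andP[ux xv].
    by move: (le_trans ux xv); rewrite leNgt vu.
  by rewrite !box0.
- exact: lebesgue_box_fin.
Qed.


Lemma measurable_addr (z : rV) : measurable_fun setT (fun x : rV => x + z).
Proof.
apply: measurable_fun_rV => j; under eq_fun do rewrite mxE.
by apply: measurable_funD; [exact: measurable_coord|exact: measurable_cst].
Qed.

Lemma measurable_subl (z : rV) : measurable_fun setT (fun x : rV => z - x).
Proof.
apply: measurable_fun_rV => j; under eq_fun do rewrite !mxE.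
by apply: measurable_funB; [exact: measurable_cst|exact: measurable_coord].
Qed.

Lemma ge0_integral_invariant (T : rV -> rV) (mT : measurable_fun setT T) (f : rV -> \bar R) :
  (forall A, measurable A -> lebesgue_rV R d (T @^-1` A) = lebesgue_rV R d A) ->
  measurable_fun setT f -> (forall x, 0 <= f x)%E ->
  (\int[lebesgue_rV R d]_x f (T x) = \int[lebesgue_rV R d]_x f x)%E.
Proof.
move=> lT mf f0.
rewrite -[LHS](@ge0_integral_pushforward _ _ _ _ _ _ mT (lebesgue_rV R d) setT f)//.
by apply: eq_measure_integral => A mA _; exact: lT.
Qed.

Lemma integrable_invariant (T : rV -> rV) (mT : measurable_fun setT T) (f : rV -> R) :
  (forall A, measurable A -> lebesgue_rV R d (T @^-1` A) = lebesgue_rV R d A) ->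
  (lebesgue_rV R d).-integrable setT (EFin \o f) ->
  (lebesgue_rV R d).-integrable setT (EFin \o (f \o T)).
Proof.
move=> lT /integrableP[mf fi]; apply/integrableP; split.
  exact: (measurableT_comp mf mT).
rewrite (ge0_integral_invariant mT (f := fun x => `|(f x)%:E|%E) lT)//.
exact: (measurableT_comp _ mf).
Qed.

Lemma Rintegral_invariant (T : rV -> rV) (mT : measurable_fun setT T) (f : rV -> R) :
  (forall A, measurable A -> lebesgue_rV R d (T @^-1` A) = lebesgue_rV R d A) ->
  (lebesgue_rV R d).-integrable setT (EFin \o f) ->
  \int[lebesgue_rV R d]_x f (T x) = \int[lebesgue_rV R d]_x f x.
Proof.
move=> lT fi; congr fine.
rewrite -[LHS](@integral_pushforward _ _ _ _ _ _ mT (lebesgue_rV R d) setT (EFin \o f))//.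
- by apply: eq_measure_integral => A mA _; exact: lT.
- by have /integrableP[] := fi.
- exact: integrable_invariant.
Qed.

Lemma lebesgue_rV_translation (z : rV) A : measurable A ->
  lebesgue_rV R d ((fun x => x + z) @^-1` A) = lebesgue_rV R d A.
Proof.
apply: lebesgue_rV_invariant; first exact: measurable_addr.
move=> a b; exists (fun j => a j - z ord0 j), (fun j => b j - z ord0 j).
split; last by move=> j; ring.
by apply/seteqP; split => x /= xab j; have := xab j; rewrite mxE => /andP[? ?];
  apply/andP; split; lra.
Qed.

Lemma lebesgue_rV_reflection (z : rV) A : measurable A ->
  lebesgue_rV R d ((fun x => z - x) @^-1` A) = lebesgue_rV R d A.
Proof.
apply: lebesgue_rV_invariant; first exact: measurable_subl.
move=> a b; exists (fun j => z ord0 j - b j), (fun j => z ord0 j - a j).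
split; last by move=> j; ring.
by apply/seteqP; split => x /= xab j; have := xab j; rewrite !mxE => /andP[? ?];
  apply/andP; split; lra.
Qed.

Lemma bounded_setP (W : set rV) :
  bounded_set W <-> exists M, forall x, W x -> `|x| <= M.
Proof.
split=> [[M [_ WM]]|[M WM]].
  by exists (M + 1) => x; apply: WM; rewrite ltrDl.
by exists M; split; [exact: num_real|move=> N MN x /WM xM; exact: le_trans (ltW MN)].
Qed.

Lemma bounded_lebesgue_fin (W : set rV) : measurable W -> bounded_set W ->
  (lebesgue_rV R d W < +oo)%E.
Proof.
move=> mW /bounded_setP[M WM]; set n := (Num.truncn M).+1.
apply: le_lt_trans (lebesgue_box_fin n).
apply: le_measure; [exact/mem_set|apply/mem_set; exact: measurable_box_rV|].
move=> x /WM xM j; rewrite -ler_norml (le_trans (le_coord_norm _ _))//.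
by rewrite (le_trans xM)// ltW// truncnS_gt.
Qed.

End boxes.

(** * The square norm and approximation by test functions *)

Section density.
Context (R : realType) (d : nat).
Local Notation rV := 'rV[R]_d.
Local Notation leb := (lebesgue_rV R d).
Implicit Types (W U : set rV) (f g : rV -> R).

(** The square of the L^2 norm: without the root, the triangle and Cauchy-Schwarz
inequalities can be replaced by the elementary bounds on [(a + b)^2] and [a b]. *)
Definition sqnorm f : \bar R := (\int[leb]_x (f x ^+ 2)%:E)%E.

Lemma sqnorm_ge0 f : (0 <= sqnorm f)%E.
Proof. by apply: integral_ge0 => x _; rewrite lee_fin sqr_ge0. Qed.

Lemma measurable_sqr f : measurable_fun setT f ->
  measurable_fun setT (fun x => (f x ^+ 2)%:E).
Proof. by move=> mf; apply/measurable_EFinP; exact: measurable_funX. Qed.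

Lemma sqnormD f g : measurable_fun setT f -> measurable_fun setT g ->
  (sqnorm (fun x => f x + g x)%R <= 2%:E * sqnorm f + 2%:E * sqnorm g)%E.
Proof.
move=> mf mg; rewrite /sqnorm.
have mZ (h : rV -> R) : measurable_fun setT h ->
    measurable_fun setT (fun x => 2%:E * (h x ^+ 2)%:E)%E.
  by move=> mh; apply: emeasurable_funM; [exact: measurable_cst|exact: measurable_sqr].
rewrite -!ge0_integralZl//; try exact: measurable_sqr;
  try by move=> *; rewrite lee_fin sqr_ge0.
rewrite -ge0_integralD//; try exact: mZ;
  try by move=> *; rewrite -EFinM lee_fin mulr_ge0// sqr_ge0.
apply: ge0_le_integral => //.
- by move=> x _; rewrite lee_fin sqr_ge0.
- by apply: measurable_sqr; exact: measurable_funD.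
- by apply: emeasurable_funD; exact: mZ.
- move=> x _; rewrite -!EFinM -EFinD lee_fin.
  have := sqr_ge0 (f x - g x); rewrite !expr2; lra.
Qed.

Definition Cc_approx W f := forall e : R, 0 < e ->
  exists2 phi, Cc W phi & (sqnorm (fun x => f x - phi x)%R < e%:E)%E.

Lemma Cc_measurable W phi : Cc W phi -> measurable_fun setT phi.
Proof. by move=> [cphi _]; exact: continuous_measurable_rV. Qed.

Lemma Cc_approx_near W f : measurable_fun setT f ->
  (forall e : R, 0 < e -> exists g, [/\ measurable_fun setT g, Cc_approx W g &
     (sqnorm (fun x => f x - g x)%R < e%:E)%E]) -> Cc_approx W f.
Proof.
move=> mf fg e e0; have e4 : 0 < e / 4 by rewrite divr_gt0.
have [g [mg ag fge]] := fg _ e4.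
have [phi Wphi gphi] := ag _ e4.
exists phi => //; have mphi := Cc_measurable Wphi.
rewrite (_ : (fun x => f x - phi x) = (fun x => (f x - g x) + (g x - phi x))); last first.
  by apply/funext => x; ring.
apply: le_lt_trans (sqnormD _ _) _; [exact: measurable_funB|exact: measurable_funB|].
have -> : e%:E = (2%:E * (e / 4)%:E + 2%:E * (e / 4)%:E)%E.
  by rewrite -!EFinM -EFinD; congr EFin; field.
by apply: lteD; rewrite lte_pmul2l.
Qed.

Lemma Cc_approxD W f g : measurable_fun setT f -> measurable_fun setT g ->
  Cc_approx W f -> Cc_approx W g -> Cc_approx W (fun x => f x + g x).
Proof.
move=> mf mg af ag e e0; have e4 : 0 < e / 4 by rewrite divr_gt0.
have [phi Wphi fphi] := af _ e4.
have [psi Wpsi gpsi] := ag _ e4.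
exists (1 *: phi + psi); first exact: Cc_linear.
have mphi := Cc_measurable Wphi; have mpsi := Cc_measurable Wpsi.
rewrite (_ : (fun x => _) = (fun x => (f x - phi x) + (g x - psi x))); last first.
  by apply/funext => x; rewrite scale1r -[(phi + psi) x]/(phi x + psi x); ring.
apply: le_lt_trans (sqnormD _ _) _; [exact: measurable_funB|exact: measurable_funB|].
have -> : e%:E = (2%:E * (e / 4)%:E + 2%:E * (e / 4)%:E)%E.
  by rewrite -!EFinM -EFinD; congr EFin; field.
by apply: lteD; rewrite lte_pmul2l.
Qed.

Lemma Cc_cst0 W : Cc W (cst 0).
Proof.
split; first exact: cst_continuous.
by exists set0; split; [exact: compact0|exact: sub0set|].
Qed.

Lemma Cc_approx0 W : Cc_approx W (fun=> 0).
Proof.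
move=> e e0; exists (cst 0); first exact: Cc_cst0.
rewrite /sqnorm (eq_integral (cst 0%E)) ?integral0//.
by move=> x _ /=; rewrite subrr expr0n.
Qed.

Lemma Cc_approxZ W (a : R) f : measurable_fun setT f ->
  Cc_approx W f -> Cc_approx W (fun x => a * f x).
Proof.
move=> mf af; have [->|a0] := eqVneq a 0.
  by under eq_fun do rewrite mul0r; exact: Cc_approx0.
move=> e e0; have a2 : 0 < a ^+ 2 by rewrite exprn_even_gt0.
have [phi Wphi fphi] := af _ (divr_gt0 e0 a2).
exists (a *: phi + cst 0); first exact: Cc_linear (Cc_cst0 W).
have mphi := Cc_measurable Wphi.
rewrite /sqnorm (eq_integral (fun x => (a ^+ 2)%:E * ((f x - phi x) ^+ 2)%:E)%E); last first.
  move=> x _; rewrite -EFinM -[(a *: phi + cst 0) x]/(a * phi x + 0) addr0.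
  by rewrite -mulrBr exprMn.
rewrite ge0_integralZl//; last first.
- by rewrite lee_fin ltW.
- by move=> x _; rewrite lee_fin sqr_ge0.
- by apply: measurable_sqr; exact: measurable_funB.
by rewrite -lte_pdivlMl// -EFinM mulrC.
Qed.

(** Dominated convergence in L^2, with dominating function [4 F^2]. *)
Lemma sqnorm_cvg (f_ : nat -> rV -> R) f F :
  (forall n, measurable_fun setT (f_ n)) -> measurable_fun setT f ->
  measurable_fun setT F ->
  (sqnorm F < +oo)%E ->
  (forall x, f_ n x @[n --> \oo] --> f x) ->
  (forall n x, `|f_ n x| <= F x) ->
  sqnorm (fun x => f x - f_ n x)%R @[n --> \oo] --> 0%E.
Proof.
move=> mf_ mf mF FL cf fF.
have fF' x : `|f x| <= F x.
  apply: (ler_cvg_to (cvg_norm (cf x)) (cvg_cst (F x))).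
  by near=> n; exact: fF.
rewrite (_ : 0%E = \int[leb]_x (cst 0%E x))%E; last by rewrite integral0.
apply: (@dominated_cvg _ _ _ leb setT measurableT _ _ (fun x => (4 * F x ^+ 2)%:E)) => //.
- by move=> n; apply: measurable_sqr; exact: measurable_funB.
- move=> x _ /=; apply: cvg_EFin; first by near=> n.
  rewrite [X in X @ _ --> _](_ : _ = (fun n => (f x - f_ n x) ^+ 2))//.
  rewrite [X in _ --> X](_ : 0 = (f x - f x) * (f x - f x)); last by rewrite subrr mulr0.
  by apply: cvgM; apply: cvgB => //; exact: cvg_cst.
- apply/integrableP; split.
    by apply/measurable_EFinP; apply: measurable_funM => //; exact: measurable_funX.
  rewrite (eq_integral (fun x => 4%:E * (F x ^+ 2)%:E)%E); last first.
    by move=> x _; rewrite gee0_abs// lee_fin mulr_ge0// sqr_ge0.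
  rewrite ge0_integralZl//; last first.
  + by move=> x _; rewrite lee_fin sqr_ge0.
  + exact: measurable_sqr.
  by rewrite lte_mul_pinfty.
- move=> n x _; rewrite gee0_abs lee_fin ?sqr_ge0//.
  have := fF n x; have := fF' x; rewrite !ler_norml => /andP[? ?] /andP[? ?].
  have F0 : 0 <= F x by lra.
  rewrite [leRHS](_ : _ = (2 * F x) ^+ 2); last by ring.
  rewrite -ler_sqrt ?sqr_ge0// !sqrtr_sqr [X in _ <= X]ger0_norm ?mulr_ge0//.
  by rewrite ler_norml; apply/andP; split; lra.
Unshelve. all: by end_near. Qed.

(** The closure property by which approximability passes from open sets to
measurable sets and from simple functions to square-integrable ones. *)
Lemma Cc_approx_cvg W (f_ : nat -> rV -> R) f F :
  (forall n, measurable_fun setT (f_ n)) -> measurable_fun setT f ->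
  measurable_fun setT F ->
  (sqnorm F < +oo)%E ->
  (forall x, f_ n x @[n --> \oo] --> f x) ->
  (forall n x, `|f_ n x| <= F x) ->
  (forall n, Cc_approx W (f_ n)) -> Cc_approx W f.
Proof.
move=> mf_ mf mF FL cf fF af; apply: Cc_approx_near => // e e0.
have c0 := sqnorm_cvg mf_ mf mF FL cf fF.
have : \forall n \near \oo, (sqnorm (fun x => f x - f_ n x)%R < e%:E)%E.
  apply: (c0 [set y | (y < e%:E)%E]).
  by apply: open_nbhs_nbhs; split; [exact: open_ereal_lt_ereal|rewrite /= lte_fin].
by move=> [n _ /(_ n (leqnn _)) fn]; exists (f_ n).
Qed.

End density.

(** * Density of C_c(W) in L^2(W) *)

Section inner_distance.
Context (R : realType) (V : normedModType R) (U : set V).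

(** The distance to the complement of [U], capped at [1]: the cap keeps the infimum
over a nonempty set when [U] is the whole space. *)
Definition inner_dist (x : V) : R := inf (1 |` [set `|x - y| | y in ~` U]).

Lemma has_inf_inner_dist x : has_inf (1 |` [set `|x - y| | y in ~` U]).
Proof.
split; first by exists 1; left.
by exists 0 => _ [->|[y _ <-]]//; exact: normr_ge0.
Qed.

Lemma inner_dist_le1 x : inner_dist x <= 1.
Proof. by apply: ge_inf; [have [] := has_inf_inner_dist x|left]. Qed.

Lemma inner_dist_le x y : ~ U y -> inner_dist x <= `|x - y|.
Proof. by move=> Uy; apply: ge_inf; [have [] := has_inf_inner_dist x|right; exists y]. Qed.

Lemma inner_dist_lipschitz x y : inner_dist x <= inner_dist y + `|x - y|.
Proof.
rewrite -lerBlDr; apply: lb_le_inf; first by have [] := has_inf_inner_dist y.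
move=> _ [->|[z Uz <-]].
  by rewrite lerBlDr (le_trans (inner_dist_le1 _))// lerDl.
rewrite lerBlDr (le_trans (inner_dist_le x Uz))//.
by rewrite (le_trans (ler_distD y _ _))// addrC.
Qed.

Lemma continuous_inner_dist : continuous inner_dist.
Proof.
move=> x; apply/cvgrPdist_le => e e0; near=> y.
have xy : `|x - y| <= e by near: y; exact: cvgr_dist_le.
have := inner_dist_lipschitz x y; have := inner_dist_lipschitz y x.
rewrite (distrC y x) ler_norml => ? ?; apply/andP; split; lra.
Unshelve. all: by end_near. Qed.

Lemma inner_dist_gt0 x : open U -> U x -> 0 < inner_dist x.
Proof.
move=> oU Ux; have /nbhs_ballP[e /= e0 eU] := open_nbhs_nbhs (conj oU Ux).
apply: (@lt_le_trans _ _ (Num.min 1 e)); first by rewrite lt_min ltr01.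
apply: lb_le_inf; first by have [] := has_inf_inner_dist x.
move=> _ [->|[z Uz <-]]; first by rewrite ge_min lexx.
rewrite ge_min; apply/orP; right; rewrite leNgt; apply/negP => xz.
by apply: Uz; apply: eU; rewrite -ball_normE.
Qed.

Lemma inner_dist_out x : ~ U x -> inner_dist x <= 0.
Proof. by move=> Ux; have := inner_dist_le x Ux; rewrite subrr normr0. Qed.

(** These functions increase to the indicator of [U].  Subtracting [1] makes them
vanish where the distance to the complement is below [1/n], which keeps their
supports at a positive distance from the complement. *)
Definition plateau (n : nat) (x : V) : R :=
  Num.min 1 (Num.max 0 (n%:R * inner_dist x - 1)).

Lemma continuous_plateau n : continuous (plateau n).
Proof.
move=> x; apply: (@continuous_min R V (cst 1)
  (fun x => Num.max 0 (n%:R * inner_dist x - 1)) x); first exact: cst_continuous.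
apply: (@continuous_max R V (cst 0) (fun x => n%:R * inner_dist x - 1) x).
  exact: cst_continuous.
apply: cvgB; last exact: cvg_cst.
by apply: cvgM; [exact: cvg_cst|exact: continuous_inner_dist].
Qed.

Lemma plateau01 n x : 0 <= plateau n x <= 1.
Proof. by rewrite /plateau le_min ler01 le_max lexx ge_min lexx. Qed.

Lemma plateau_support n x : n%:R * inner_dist x < 1 -> plateau n x = 0.
Proof.
move=> ndx; rewrite /plateau (_ : Num.max _ _ = 0); first by rewrite min_r.
by rewrite max_l// subr_le0 ltW.
Qed.

Lemma plateau_out n x : ~ U x -> plateau n x = 0.
Proof.
move=> Ux; apply: plateau_support; apply: (@le_lt_trans _ _ 0) => //.
by rewrite mulr_ge0_le0// inner_dist_out.
Qed.

Lemma plateau_cvg : open U -> forall x, plateau n x @[n --> \oo] --> (\1_U x : R).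
Proof.
move=> oU x; have [Ux|Ux] := pselect (U x); last first.
  rewrite indicE memNset// (_ : (fun n => _) = cst 0); first exact: cvg_cst.
  by apply/funext => n; rewrite plateau_out.
rewrite indicE mem_set//=; have dx := inner_dist_gt0 oU Ux.
apply: cvg_near_cst; near=> n.
rewrite /plateau min_l// le_max; apply/orP; right.
rewrite lerBrDr -ler_pdivrMr//; near: n; exact: nbhs_infty_ger.
Unshelve. all: by end_near. Qed.

End inner_distance.

Section density.
Context (R : realType) (d : nat) (W : set 'rV[R]_d).
Hypotheses (oW : open W) (bW : bounded_set W).
Local Notation rV := 'rV[R]_d.
Local Notation leb := (lebesgue_rV R d).
Implicit Types (A U : set rV) (f g : rV -> R).

Let mW : measurable W. Proof. exact: open_measurable_rV. Qed.

Lemma Cc_approx_Cc phi : Cc W phi -> Cc_approx W phi.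
Proof.
move=> Wphi e e0; exists phi => //.
rewrite /sqnorm (eq_integral (cst 0%E)) ?integral0//.
by move=> x _ /=; rewrite subrr expr0n.
Qed.

Lemma Cc_plateau U n : open U -> U `<=` W -> Cc W (plateau U n).
Proof.
move=> oU UW; split; first exact: continuous_plateau.
have KU : [set x | 1 <= n%:R * inner_dist U x] `<=` U.
  move=> x /= nx; apply: contrapT => /inner_dist_out dx.
  have : n%:R * inner_dist U x <= 0 by rewrite mulr_ge0_le0.
  by rewrite leNgt (lt_le_trans ltr01 nx).
exists [set x | 1 <= n%:R * inner_dist U x]; split.
- apply: bounded_closed_compact.
    have /bounded_setP[M WM] := bW.
    by apply/bounded_setP; exists M => x /KU/UW/WM.
  have cn : continuous (fun x => n%:R * inner_dist U x).
    by move=> x; exact: (cvgM (cvg_cst (n%:R : R)) (@continuous_inner_dist R rV U x)).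
  apply: (@closed_comp _ _ (fun x => n%:R * inner_dist U x) [set y | 1 <= y]).
    by move=> x _; exact: cn.
  exact: closed_ge.
- exact: subset_trans UW.
- move=> x /= /negP; rewrite -ltNge; exact: plateau_support.
Qed.

Lemma sqnorm_indic A : measurable A -> sqnorm (\1_A : rV -> R) = leb A.
Proof.
move=> mA; rewrite /sqnorm -[in RHS](setIT A) -integral_indic//.
apply: eq_integral => x _; congr EFin; rewrite indicE.
by case: (x \in A); rewrite ?expr1n ?expr0n.
Qed.

Lemma sqnorm_indicW : (sqnorm (\1_W : rV -> R) < +oo)%E.
Proof. by rewrite sqnorm_indic//; exact: bounded_lebesgue_fin. Qed.

Lemma indic_le A x : A `<=` W -> `|\1_A x| <= \1_W x :> R.
Proof.
move=> AW; rewrite !indicE ger0_norm ?ler0n// ler_nat.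
by have [/set_mem/AW/mem_set ->|] := boolP (x \in A).
Qed.

Lemma Cc_approx_open U : open U -> U `<=` W -> Cc_approx W \1_U.
Proof.
move=> oU UW; apply: (@Cc_approx_cvg _ _ _ (plateau U) _ \1_W).
- by move=> n; apply: continuous_measurable_rV; exact: continuous_plateau.
- by apply: measurable_indic; exact: open_measurable_rV.
- exact: measurable_indic.
- exact: sqnorm_indicW.
- exact: plateau_cvg.
- move=> n x; have [Ux|Ux] := pselect (U x); last first.
    by rewrite plateau_out// normr0 indicE ler0n.
  rewrite indicE (mem_set (UW _ Ux)).
  by have /andP[? ?] := plateau01 U n x; rewrite ger0_norm.
- by move=> n; apply: Cc_approx_Cc; exact: Cc_plateau.
Qed.

(** The sets [A] for which the indicator of [A `&` W] is approximable form a Dynkin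
system containing the open sets. *)
Lemma Cc_approx_indic A : measurable A -> Cc_approx W \1_(A `&` W).
Proof.
move=> mA; apply: (@dynkin_induction _ rV open (fun A => Cc_approx W \1_(A `&` W)) erefl) => //.
- exact: openI.
- by rewrite setTI; exact: Cc_approx_open.
- by move=> U oU; apply: Cc_approx_open; [exact: openI|exact: subIsetr].
- move=> S mS aS.
  rewrite (_ : \1_(~` S `&` W) = (fun x => \1_W x + (-1) * \1_(S `&` W) x)); last first.
    apply/funext => x; rewrite !indicE !in_setI in_setC.
    by case: (x \in S); case: (x \in W) => /=; ring.
  apply: Cc_approxD; first exact: measurable_indic.
  + by apply: measurable_funM => //; apply: measurable_indic; exact: measurableI.
  + exact: Cc_approx_open.
  + by apply: Cc_approxZ => //; apply: measurable_indic; exact: measurableI.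
- move=> F mF tF aF.
  pose G n := \big[setU/set0]_(i < n) F i.
  have mG n : measurable (G n) by exact: bigsetU_measurable.
  have G0 n : G n `&` F n = set0.
    rewrite /G big_distrl/= big1// => i _.
    by move/trivIsetP : tF => /(_ i n I I); apply; rewrite neq_ltn ltn_ord.
  have aG n : Cc_approx W \1_(G n `&` W).
    elim: n => [|n IH].
      by rewrite /G big_ord0 set0I indic0; exact: Cc_approx0.
    rewrite (_ : \1_(_) = (fun x => \1_(G n `&` W) x + \1_(F n `&` W) x)).
      by apply: Cc_approxD => //; apply: measurable_indic; exact: measurableI.
    apply/funext => x; rewrite !indicE /G big_ord_recr/= -/(G n) !in_setI in_setU.
    have : ~~ ((x \in G n) && (x \in F n)) by rewrite -in_setI G0 in_set0.
    by case: (x \in G n); case: (x \in F n); case: (x \in W) => //= _;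
      rewrite ?addr0 ?add0r.
  apply: (@Cc_approx_cvg _ _ _ (fun n => \1_(G n `&` W)) _ \1_W) => //.
  + by move=> n; apply: measurable_indic; exact: measurableI.
  + by apply: measurable_indic; apply: measurableI => //; exact: bigcup_measurable.
  + exact: sqnorm_indicW.
  + move=> x; apply: cvg_near_cst.
    have [[k _ Fkx]|nFx] := pselect ((\bigcup_k F k) x).
      exists k.+1 => // n /= kn; rewrite !indicE !in_setI; congr ((_ && _)%:R).
      rewrite !mem_set//; first by exists k.
      by rewrite /G -bigcup_mkord; exists k.
    near=> n; rewrite !indicE !in_setI; congr ((_ && _)%:R).
    rewrite !memNset// /G -bigcup_mkord => -[k _ Fkx].
    by apply: nFx; exists k.
  + by move=> n x; apply: indic_le; exact: subIsetr.
Unshelve. all: by end_near. Qed.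

Import HBNNSimple.

Lemma Cc_approx_ge0 f : measurable_fun setT f -> (forall x, 0 <= f x) ->
  vanishes_off W f -> (sqnorm f < +oo)%E -> Cc_approx W f.
Proof.
move=> mf f0 Wf fL.
have mEf : measurable_fun setT (EFin \o f) by exact/measurable_EFinP.
pose g := nnsfun_approx measurableT mEf.
have gf x : g n x @[n --> \oo] --> f x.
  apply: (@fine_cvg _ _ _ _ (EFin \o (fun n => g n x))).
  by apply: (@cvg_nnsfun_approx _ _ _ _ measurableT _ mEf) => // y _; rewrite lee_fin.
have ndg x : nondecreasing_seq (fun n => g n x).
  by move=> m n mn; have /lefP := nd_nnsfun_approx measurableT mEf mn.
have g_le n x : g n x <= f x.
  rewrite -(cvg_lim _ (gf x))//; apply: nondecreasing_cvgn_le => //.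
  by apply/cvg_ex; exists (f x).
apply: (@Cc_approx_cvg _ _ _ (fun n => g n) _ f) => //.
- by move=> n x; rewrite ger0_norm.
- move=> n.
  rewrite (_ : (g n : rV -> R) = (fun x => \sum_(y <- fset_set (range (g n)))
      y * \1_((g n @^-1` [set y]) `&` W) x)); last first.
    apply/funext => x; rewrite fimfunE fsbig_finite//=.
    apply: eq_bigr => y _; rewrite !indicE in_setI.
    have [Wx|nWx] := pselect (W x); first by rewrite (mem_set Wx) andbT.
    rewrite (memNset nWx) andbF mulr0.
    have [/set_mem /= gy|] := boolP (x \in _); last by rewrite mulr0.
    rewrite mulr1 -gy; apply/eqP; rewrite eq_le; apply/andP; split => //.
    by rewrite -(Wf _ nWx).
  elim: (enum_fset (fset_set (range (g n)))) => [|y s IH].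
    by under eq_fun do rewrite big_nil; exact: Cc_approx0.
  under eq_fun do rewrite big_cons.
  have mgy z : measurable (g n @^-1` [set z] `&` W).
    by apply: measurableI.
  apply: Cc_approxD => //.
  + by apply: measurable_funM => //; exact: measurable_indic.
  + by apply: measurable_sum => z; apply: measurable_funM => //; exact: measurable_indic.
  + by apply: Cc_approxZ; [exact: measurable_indic|exact: Cc_approx_indic].
Unshelve. all: by end_near. Qed.

(** Positive and negative parts reduce this to nonnegative functions, which are
dominated limits of simple functions. *)
Theorem Cc_dense_L2 f : measurable_fun setT f ->
  vanishes_off W f -> (sqnorm f < +oo)%E -> Cc_approx W f.
Proof.
move=> mf Wf fL.
have part (h : rV -> R) : measurable_fun setT h -> vanishes_off W h ->
    (sqnorm h < +oo)%E -> Cc_approx W (fun x => Num.max (h x) 0).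
  move=> mh Wh hL; have mh0 : measurable_fun setT (fun x => Num.max (h x) 0).
    exact: measurable_maxr.
  apply: Cc_approx_ge0 => //.
  - by move=> x; rewrite le_max lexx orbT.
  - by move=> x Wx; rewrite Wh// maxxx.
  - apply: le_lt_trans hL; apply: ge0_le_integral => //.
    + by move=> x _; rewrite lee_fin sqr_ge0.
    + exact: measurable_sqr.
    + exact: measurable_sqr.
    + move=> x _; rewrite lee_fin; have [h0|h0] := leP (h x) 0; last by [].
      by rewrite expr0n sqr_ge0.
rewrite (_ : f = fun x => Num.max (f x) 0 + (-1) * Num.max (- f x) 0); last first.
  apply/funext => x; have [f0|f0] := leP (f x) 0.
    by rewrite max_l ?oppr_ge0//; ring.
  by rewrite max_r ?oppr_le0 1?ltW//; ring.
have mNf : measurable_fun setT (fun x => - f x) by exact: measurableT_comp.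
have sNf : sqnorm (fun x => - f x) = sqnorm f.
  by apply: eq_integral => x _; rewrite sqrrN.
have WNf : vanishes_off W (fun x => - f x) by move=> x Wx; rewrite Wf// oppr0.
apply: Cc_approxD.
- exact: measurable_maxr.
- by apply: measurable_funM => //; exact: measurable_maxr.
- exact: part.
- apply: Cc_approxZ; first exact: measurable_maxr.
  by apply: part => //; rewrite sNf.
Qed.

End density.

(** * Exchange of integrals and continuity of parametric integrals *)

Section sigma_finite_version.
Context dT (T : measurableType dT) (R : realType) (m : {measure set T -> \bar R}).

(** A name for [m] that depends on a proof of sigma-finiteness, so that the
sigma-finite structure can be attached to it. *)
Definition sigma_finite_version (s : sigma_finite setT m) : set T -> \bar R := m.

Context (s : sigma_finite setT m).

HB.instance Definition _ := Measure.copy (sigma_finite_version s) m.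
HB.instance Definition _ := Measure_isSigmaFinite.Build _ _ _ (sigma_finite_version s) s.

End sigma_finite_version.

(** Fubini's theorem; the integrable majorant [b] of the inner integrals is an
iterated form of integrability for the product measure. *)
Lemma Rintegral_exchange d1 d2 (T1 : measurableType d1) (T2 : measurableType d2)
    (R : realType) (m1 : {measure set T1 -> \bar R}) (m2 : {measure set T2 -> \bar R})
    (f : T1 * T2 -> R) (b : T1 -> R) :
  sigma_finite setT m1 -> sigma_finite setT m2 ->
  measurable_fun setT f ->
  m1.-integrable setT (EFin \o b) ->
  (forall x, \int[m2]_y `|(f (x, y))%:E| <= (b x)%:E)%E ->
  (forall x, m2.-integrable setT (fun y => (f (x, y))%:E)) ->
  (forall y, m1.-integrable setT (fun x => (f (x, y))%:E)) ->
  \int[m1]_x \int[m2]_y f (x, y) = \int[m2]_y \int[m1]_x f (x, y).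
Proof.
move=> s1 s2 mf ib fb fx fy; rewrite /Rintegral; congr fine.
transitivity (\int[m1]_x \int[m2]_y (f (x, y))%:E)%E.
  by apply: eq_integral => x _; rewrite fineK//; exact: integrable_fin_num.
transitivity (\int[m2]_y \int[m1]_x (f (x, y))%:E)%E; last first.
  by apply: eq_integral => y _; rewrite fineK//; exact: integrable_fin_num.
apply: (@Fubini _ _ _ _ _ (sigma_finite_version s1) (sigma_finite_version s2)
  (EFin \o f)) => //.
apply/integrable12ltyP; first exact/measurable_EFinP.
apply: le_lt_trans (integrable_lty measurableT ib).
apply: ge0_le_integral => //.
- by move=> x _; exact: integral_ge0.
- apply: (@measurable_fun_fubini_tonelli_F _ _ _ _ _ (sigma_finite_version s2)
    (fun p => `|(f p)%:E|%E)) => //.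
  by apply: measurableT_comp => //; exact/measurable_EFinP.
- exact: measurable_int ib.
- by move=> x _; exact: fb.
Qed.

Lemma continuous_eps_delta (R : realType) (V : normedModType R) (u : V -> R) :
  (forall y e, 0 < e -> exists2 r, 0 < r &
    forall z, `|y - z| < r -> `|u y - u z| <= e) ->
  continuous u.
Proof.
move=> ued y; apply/cvgrPdist_le => e e0; have [r r0 yr] := ued y e e0.
by apply: filterS (nbhsx_ballx y r r0) => z; rewrite -ball_normE; exact: yr.
Qed.

Lemma continuous_uniform_limit (R : realType) (V : normedModType R) (u : V -> R) :
  (forall e, 0 < e -> exists2 v : V -> R, continuous v &
    forall z, `|u z - v z| <= e) ->
  continuous u.
Proof.
move=> uv y; apply/cvgrPdist_le => e e0.
have e3 : 0 < e / 3 by rewrite divr_gt0.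
have [v cv uve] := uv _ e3.
have /cvgrPdist_le/(_ _ e3) := cv y.
apply: filterS => z yz.
have -> : u y - u z = (u y - v y) + (v y - v z) - (u z - v z) by ring.
rewrite (le_trans (ler_normB _ _))// (_ : e = (e / 3 + e / 3) + e / 3); last by field.
by rewrite lerD// (le_trans (ler_normD _ _))// lerD.
Qed.

Section functions.
Context (R : realType) (d : nat).
Local Notation rV := 'rV[R]_d.
Local Notation leb := (lebesgue_rV R d).
Implicit Types (W w : set rV) (f g h phi : rV -> R).

(** Compactness of the support [K] gives a uniform modulus at the points of [K];
if neither point is in [K], both values are zero. *)
Lemma uniformly_continuous_Cc w phi : Cc w phi -> forall e : R, 0 < e ->
  exists2 r : R, 0 < r & forall x y, `|x - y| < r -> `|phi x - phi y| <= e.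
Proof.
move=> [cphi [K [cK _ phiK]]] e e0.
have /compact_near_coveringP nK := cK.
pose P (r : R) (x : rV) := forall y, `|x - y| < r -> `|phi x - phi y| <= e.
have /(nK _ _ P) : Filter (0^'+ : set_system R) by exact: at_right_proper_filter.
have e2 : 0 < e / 2 by rewrite divr_gt0.
case=> [x Kx|r r0 rK].
  have /cvgrPdist_le/(_ _ e2)/nbhs_ballP[r /= r0 xr] := cphi x.
  rewrite -ball_normE /= in xr.
  have r2 : 0 < r / 2 by rewrite divr_gt0.
  exists (ball x (r / 2), [set s | s < r / 2]).
    split; first exact: nbhsx_ballx.
    exact: nbhs_right_lt.
  move=> [x' s] /=; rewrite -ball_normE /= => -[xx' sr] y x'y.
  have -> : phi x' - phi y = (phi x - phi y) - (phi x - phi x') by ring.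
  rewrite (le_trans (ler_normB _ _))// [e]splitr lerD//.
    apply: xr; rewrite /= (_ : x - y = (x - x') + (x' - y)); last by rewrite subrKA.
    by rewrite (le_lt_trans (ler_normD _ _))// [r]splitr ltrD// (lt_trans x'y).
  by apply: xr => /=; lra.
have r2 : 0 < r / 2 by rewrite divr_gt0.
have rKP : K `<=` P (r / 2).
  apply: rK => //=; rewrite sub0r normrN gtr0_norm//.
  by rewrite ltr_pdivrMr// ltr_pMr// ltr1n.
exists (r / 2) => // x y xy.
have [Kx|Kx] := pselect (K x); first exact: rKP.
have [Ky|Ky] := pselect (K y); first by rewrite distrC; apply: rKP => //; rewrite distrC.
by rewrite !phiK// subrr normr0 ltW.
Qed.

Lemma bounded_Cc w phi : Cc w phi -> exists C, forall x, `|phi x| <= C.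
Proof.
move=> [cphi [K [cK _ phiK]]].
have /compact_bounded[M [_ KM]] : compact (phi @` K : set R^o).
  by apply: continuous_compact => //; exact: continuous_subspaceT.
exists (Num.max (M + 1) 0) => x; have [Kx|Kx] := pselect (K x).
  by rewrite le_max KM//= ?ltrDl//; exists x.
by rewrite phiK// normr0 le_max lexx orbT.
Qed.

Lemma integrable_sqnorm f g : measurable_fun setT f -> measurable_fun setT g ->
  (sqnorm f < +oo)%E -> (sqnorm g < +oo)%E ->
  leb.-integrable setT (fun x => (f x * g x)%:E).
Proof.
move=> mf mg fL gL; apply/integrableP; split.
  by apply/measurable_EFinP; exact: measurable_funM.
apply: (@le_lt_trans _ _ (sqnorm f + sqnorm g)%E); last by rewrite lte_add_pinfty.
rewrite -ge0_integralD//; try exact: measurable_sqr;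
  try by move=> *; rewrite lee_fin sqr_ge0.
apply: ge0_le_integral => //.
- apply: measurableT_comp => //; apply/measurable_EFinP; exact: measurable_funM.
- by apply: emeasurable_funD; exact: measurable_sqr.
- move=> x _; rewrite -EFinD abse_EFin lee_fin ler_norml.
  have := sqr_ge0 (f x - g x); have := sqr_ge0 (f x + g x).
  have := sqr_ge0 (f x); have := sqr_ge0 (g x); rewrite !expr2 => ? ? ? ?.
  by apply/andP; split; lra.
Qed.

(** Young's inequality; letting [t] vary recovers Cauchy-Schwarz, with no root. *)
Lemma Rintegral_le_sqnorm (t : R) f g : 0 < t ->
  measurable_fun setT f -> measurable_fun setT g ->
  (sqnorm f < +oo)%E -> (sqnorm g < +oo)%E ->
  `|\int[leb]_x (f x * g x)| <= t * fine (sqnorm f) + t^-1 * fine (sqnorm g).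
Proof.
move=> t0 mf mg fL gL; have fg := integrable_sqnorm mf mg fL gL.
apply: (le_trans (le_normr_Rintegral _ fg)) => //.
have sfin h : (sqnorm h < +oo)%E -> sqnorm h \is a fin_num.
  by move=> hL; rewrite ge0_fin_numE// sqnorm_ge0.
rewrite -lee_fin /Rintegral fineK; last first.
  by apply: integrable_fin_num => //; exact: integrable_norm.
rewrite EFinD !EFinM !fineK ?sfin//.
have t0' : 0 <= t^-1 by rewrite invr_ge0 ltW.
rewrite -!ge0_integralZl//; try exact: measurable_sqr;
  try (by move=> *; rewrite lee_fin sqr_ge0); try by rewrite lee_fin ltW.
have mZ (s : R) (h : rV -> R) : measurable_fun setT h ->
    measurable_fun setT (fun x => s%:E * (h x ^+ 2)%:E)%E.
  by move=> mh; apply: emeasurable_funM; [exact: measurable_cst|exact: measurable_sqr].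
rewrite -ge0_integralD//; try exact: mZ;
  try by move=> *; rewrite -EFinM lee_fin mulr_ge0 ?sqr_ge0// ltW.
apply: ge0_le_integral => //.
- apply/measurable_EFinP; apply: measurableT_comp => //; exact: measurable_funM.
- by apply: emeasurable_funD; exact: mZ.
move=> x _; rewrite -!EFinM -EFinD lee_fin ler_norml.
have H1 := sqr_ge0 (t * f x - g x); have H2 := sqr_ge0 (t * f x + g x).
have E1 : t^-1 * (t * f x - g x) ^+ 2 = t * f x ^+ 2 + t^-1 * g x ^+ 2 - 2 * (f x * g x).
  by field; rewrite gt_eqF.
have E2 : t^-1 * (t * f x + g x) ^+ 2 = t * f x ^+ 2 + t^-1 * g x ^+ 2 + 2 * (f x * g x).
  by field; rewrite gt_eqF.
have := mulr_ge0 t0' H1; have := mulr_ge0 t0' H2; rewrite E1 E2 => ? ?.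
have p1 : 0 <= t * f x ^+ 2 by rewrite mulr_ge0 ?sqr_ge0// ltW.
have p2 : 0 <= t^-1 * g x ^+ 2 by rewrite mulr_ge0 ?sqr_ge0.
by apply/andP; split; lra.
Qed.

Lemma integrable_bounded_mul phi g (C : R) : measurable_fun setT phi ->
  (forall x, `|phi x| <= C) -> leb.-integrable setT (EFin \o g) ->
  leb.-integrable setT (fun x => (phi x * g x)%:E).
Proof.
move=> mphi phiC ig; have /measurable_EFinP mg := measurable_int _ ig.
apply: (@le_integrable _ _ _ _ _ _ _ (fun x => C%:E * (g x)%:E)%E) => //.
- by apply/measurable_EFinP; exact: measurable_funM.
- move=> x _; rewrite -EFinM !abse_EFin lee_fin !normrM ler_wpM2r//.
  by rewrite (le_trans (phiC x))// ler_norm.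
- exact: integrableZl.
Qed.

(** The hypothesis on [T] covers the two families [x + y] and [y - x] that occur in
correlations and convolutions: moving the parameter moves all points [T y x] by the
same vector, so uniform continuity of [phi] applies at once for all [x]. *)
Lemma continuous_param_integral w phi g (T : rV -> rV -> rV) :
  Cc w phi -> leb.-integrable setT (EFin \o g) ->
  (forall y, measurable_fun setT (T y)) ->
  (forall x y y', T y x - T y' x = y - y') ->
  continuous (fun y => \int[leb]_x (phi (T y x) * g x)).
Proof.
move=> Wphi ig mT TB; apply: continuous_eps_delta => y; have [C phiC] := bounded_Cc Wphi.
have mphi := Cc_measurable Wphi.
have iT z : leb.-integrable setT (fun x => (phi (T z x) * g x)%:E).
  apply: (integrable_bounded_mul (C := C)) => //.
  exact: (measurableT_comp mphi (mT z)).
have ign := integrable_norm ig.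
pose G := \int[leb]_x `|g x|.
have G0 : 0 <= G by apply: Rintegral_ge0.
move=> e e0.
have eG : 0 < e / (G + 1) by rewrite divr_gt0// ltr_wpDl.
have [r r0 phir] := uniformly_continuous_Cc Wphi eG.
exists r => // z yz; rewrite -(RintegralB measurableT (iT y) (iT z)).
under eq_Rintegral do rewrite -mulrBl.
have iB : leb.-integrable setT (fun x => ((phi (T y x) - phi (T z x)) * g x)%:E).
  have := integrableB measurableT (iT y) (iT z).
  by under eq_fun do rewrite -EFinB -mulrBl.
rewrite (le_trans (le_normr_Rintegral _ iB))//.
apply: (@le_trans _ _ (\int[leb]_x (e / (G + 1) * `|g x|))).
  apply: le_Rintegral => //; first exact: (integrable_norm iB).
    exact: (integrableZl _ _ ign).
  move=> x _; rewrite normrM ler_wpM2r//.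
  by apply: phir; rewrite TB.
rewrite RintegralZl// -/G -mulrA ler_piMr// ?(ltW e0)//.
by rewrite mulrC ler_pdivrMr ?ltr_wpDl// mul1r lerDl.
Qed.

End functions.

(** * Correlation and convolution *)

Section convolution.
Context (R : realType) (d : nat).
Local Notation rV := 'rV[R]_d.
Local Notation leb := (lebesgue_rV R d).
Implicit Types (W w S : set rV) (f g h phi : rV -> R).

Lemma compact_closure_bounded S : bounded_set S -> compact (closure S).
Proof.
move=> /bounded_setP[M SM]; apply: bounded_closed_compact; last exact: closed_closure.
apply/bounded_setP; exists M.
have cM : closed [set x : rV | `|x| <= M].
  apply: (@closed_comp _ _ (fun x : rV => `|x|) [set y | y <= M]) => [x _|].
    exact: norm_continuous.
  exact: closed_le.
by move=> x /(closure_subset SM); rewrite -(closure_id _).1.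
Qed.

Lemma Rintegral_vanishes_off W f : vanishes_off W f ->
  \int[leb]_(x in W) f x = \int[leb]_x f x.
Proof.
move=> Wf; rewrite Rintegral_mkcond; apply: eq_Rintegral => x _.
by rewrite patchE; case: ifPn => // /negP xW; rewrite Wf// => Wx; apply/xW/mem_set.
Qed.

Lemma correlationE S g phi y : vanishes_off S g ->
  correlation S g phi y = \int[leb]_x (phi (x + y) * g x).
Proof.
by move=> Sg; apply: Rintegral_vanishes_off => x /Sg ->; rewrite mulr0.
Qed.

(** The support lies in [K - closure S], where [K] is the support of [phi].  This
compact set is still contained in [w - S]: as [w] is open, a point [s] of the
closure can be replaced by a nearby point [s'] of [S] and [k] by [k + s' - s]. *)
Lemma Cc_correlation w S g phi : open w -> bounded_set S -> vanishes_off S g ->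
  leb.-integrable setT (EFin \o g) -> Cc w phi ->
  Cc (setsub w S) (correlation S g phi).
Proof.
move=> ow bS Sg ig Wphi; split.
  rewrite (_ : correlation S g phi = fun y => \int[leb]_x (phi (x + y) * g x)); last first.
    by apply/funext => y; rewrite correlationE.
  apply: (continuous_param_integral (T := fun y x => x + y) Wphi ig).
    by move=> y; exact: measurable_addr.
  by move=> x y y'; rewrite opprD addrACA subrr add0r.
have [cphi [K [cK Kw phiK]]] := Wphi.
exists [set p.1 - p.2 | p in K `*` closure S]; split.
- apply: continuous_compact; last exact: compact_setX cK (compact_closure_bounded bS).
  apply: continuous_subspaceT => -[x y].
  exact: (cvgB (@cvg_fst _ _ _ _ _) (@cvg_snd _ _ _ _ _)).
- move=> _ [[k s] /= [Kk Ss] <-].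
  have /nbhs_ballP[e /= e0 ew] := open_nbhs_nbhs (conj ow (Kw _ Kk)).
  have [s' [Ss' ss']] := Ss _ (nbhsx_ballx s e e0).
  exists (k + (s' - s)).
    apply: ew; move: ss'; rewrite -!ball_normE /=.
    by rewrite opprD addrA subrr add0r opprB.
  by exists s' => //; rewrite addrA addrAC addrK.
- move=> y Ky; rewrite correlationE// (_ : (fun x => _) = cst 0).
    by rewrite Rintegral_cst// mul0r.
  apply/funext => x; have [Sx|Sx] := pselect (S x); last by rewrite Sg ?mulr0.
  rewrite phiK ?mul0r// => Kxy; apply: Ky; exists (x + y, x) => /=.
    by split => //; exact: subset_closure.
  by rewrite addrAC subrr add0r.
Qed.

Definition convolution h g (z : rV) : R := \int[leb]_x (h (z - x) * g x).

Lemma measurable_reflect f (z : rV) : measurable_fun setT f ->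
  measurable_fun setT (fun x : rV => f (z - x)).
Proof. by move=> mf; exact: (measurableT_comp mf (@measurable_subl R d z)). Qed.

Lemma sqnorm_reflect f (z : rV) : measurable_fun setT f ->
  sqnorm (fun x => f (z - x)) = sqnorm f.
Proof.
move=> mf.
apply: (ge0_integral_invariant (@measurable_subl R d z) (f := fun x => (f x ^+ 2)%:E)).
- exact: lebesgue_rV_reflection.
- exact: measurable_sqr.
- by move=> x; rewrite lee_fin sqr_ge0.
Qed.

Lemma integrable_convolution h g z : measurable_fun setT h -> measurable_fun setT g ->
  (sqnorm h < +oo)%E -> (sqnorm g < +oo)%E ->
  leb.-integrable setT (fun x => (h (z - x) * g x)%:E).
Proof.
move=> mh mg hL gL.
apply: (integrable_sqnorm (f := fun x => h (z - x))) => //; first exact: measurable_reflect.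
by rewrite sqnorm_reflect.
Qed.

Lemma le_convolution (t : R) h g z : 0 < t ->
  measurable_fun setT h -> measurable_fun setT g ->
  (sqnorm h < +oo)%E -> (sqnorm g < +oo)%E ->
  `|convolution h g z| <= t * fine (sqnorm h) + t^-1 * fine (sqnorm g).
Proof.
move=> t0 mh mg hL gL; rewrite -(sqnorm_reflect z mh).
by apply: (Rintegral_le_sqnorm (f := fun x => h (z - x))) => //;
  [exact: measurable_reflect|rewrite sqnorm_reflect].
Qed.

(** Approximating [h] in L^2 by test functions approximates the convolution
uniformly, since reflection and translation preserve the L^2 norm. *)
Lemma continuous_convolution W h g : open W -> bounded_set W ->
  measurable_fun setT h -> vanishes_off W h -> (sqnorm h < +oo)%E ->
  measurable_fun setT g -> leb.-integrable setT (EFin \o g) -> (sqnorm g < +oo)%E ->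
  continuous (convolution h g).
Proof.
move=> oW bW mh Wh hL mg ig gL.
apply: continuous_uniform_limit => e e0.
pose G := fine (sqnorm g).
have G0 : 0 <= G by rewrite fine_ge0// sqnorm_ge0.
(* with this [t], the term of Young's inequality that has the factor [t^-1] is at
   most [e / 2]; the approximation of [h] is then chosen after [t] *)
pose t := 2 * (G + 1) / e.
have t0 : 0 < t by rewrite divr_gt0// mulr_gt0// ltr_wpDl.
have et : 0 < e / (2 * t) by rewrite divr_gt0// mulr_gt0.
have [phi Wphi hphi] := Cc_dense_L2 oW bW mh Wh hL et.
have mphi := Cc_measurable Wphi.
exists (convolution phi g).
  apply: (continuous_param_integral (T := fun z x => z - x) Wphi ig).
    by move=> z; exact: measurable_subl.
  by move=> x y y'; rewrite opprB addrA subrK.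
move=> z.
have mhp : measurable_fun setT (fun x => h x - phi x) by exact: measurable_funB.
have hpL : (sqnorm (fun x => h x - phi x)%R < +oo)%E by rewrite (lt_trans hphi)// ltry.
have iphi : leb.-integrable setT (fun x => (phi (z - x) * g x)%:E).
  have [C phiC] := bounded_Cc Wphi.
  by apply: (integrable_bounded_mul (C := C)) => //; exact: measurable_reflect.
have -> : convolution h g z - convolution phi g z =
    convolution (fun x => h x - phi x) g z.
  rewrite /convolution -(RintegralB measurableT (integrable_convolution z mh mg hL gL) iphi).
  by apply: eq_Rintegral => x _; rewrite mulrBl.
apply: le_trans (le_convolution z t0 mhp mg hpL gL) _.
rewrite [leRHS]splitr lerD//.
  have -> : e / 2 = t * (e / (2 * t)) by field; rewrite gt_eqF.
  rewrite ler_wpM2l ?(ltW t0)// -lee_fin fineK ?ltW//.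
  by rewrite ge0_fin_numE ?sqnorm_ge0.
have -> : t^-1 = e / 2 / (G + 1).
  by rewrite /t; field; rewrite !gt_eqF// ltr_wpDl.
by rewrite -(mulrA (e / 2)) ler_piMr ?divr_ge0 ?(ltW e0)//
  mulrC ler_pdivrMr ?ltr_wpDl// mul1r lerDl.
Qed.

(** Exchange the integrals, substitute [y = z - x], and exchange again. *)
Lemma convolution_adjoint phi g h (C : R) :
  measurable_fun setT phi -> (forall x, `|phi x| <= C) ->
  leb.-integrable setT (EFin \o g) -> leb.-integrable setT (EFin \o h) ->
  (sqnorm g < +oo)%E -> (sqnorm h < +oo)%E ->
  \int[leb]_y (h y * \int[leb]_x (phi (x + y) * g x)) =
  \int[leb]_z (convolution h g z * phi z).
Proof.
move=> mphi phiC ig ih gL hL.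
have mg : measurable_fun setT g by have /measurable_EFinP := measurable_int _ ig.
have mh : measurable_fun setT h by have /measurable_EFinP := measurable_int _ ih.
have C0 : 0 <= C by apply: le_trans (phiC 0).
have sf := @lebesgue_rV_sigma_finite R d.
have mD : measurable_fun setT (fun p : rV * rV => p.1 + p.2).
  apply: measurable_fun_rV => j; under eq_fun do rewrite mxE.
  apply: measurable_funD.
    by apply: (measurableT_comp (measurable_coord j)); exact: measurable_fst.
  by apply: (measurableT_comp (measurable_coord j)); exact: measurable_snd.
have mB : measurable_fun setT (fun p : rV * rV => p.1 - p.2).
  apply: measurable_fun_rV => j; under eq_fun do rewrite !mxE.
  apply: measurable_funB.
    by apply: (measurableT_comp (measurable_coord j)); exact: measurable_fst.
  by apply: (measurableT_comp (measurable_coord j)); exact: measurable_snd.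
have hm x : leb.-integrable setT (fun z => (h (z - x))%:E).
  apply: (integrable_invariant (@measurable_addr R d (- x)) _ ih).
  exact: lebesgue_rV_translation.
have igy y : leb.-integrable setT (fun x => (phi (x + y) * g x)%:E).
  apply: (integrable_bounded_mul (C := C)) => //.
  exact: (measurableT_comp mphi (@measurable_addr _ _ y)).
have ihx x : leb.-integrable setT (fun y => (phi (x + y) * h y)%:E).
  apply: (integrable_bounded_mul (C := C)) => //.
  by under eq_fun do rewrite addrC; exact: (measurableT_comp mphi (@measurable_addr _ _ x)).
have ihz x : leb.-integrable setT (fun z => (phi z * h (z - x))%:E).
  exact: (@integrable_bounded_mul R d phi (fun z => h (z - x)) C mphi phiC (hm x)).
have iZ (f : rV -> R) (k : R) : leb.-integrable setT (EFin \o f) ->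
    leb.-integrable setT (fun x => (k * f x)%:E).
  by move=> fi; under eq_fun do rewrite EFinM; exact: integrableZl.
have bound (psi f : rV -> R) (k : R) : measurable_fun setT psi -> (forall x, `|psi x| <= C) ->
    leb.-integrable setT (EFin \o f) ->
    (\int[leb]_x `|(k * (psi x * f x))%:E| <= (`|k| * (C * \int[leb]_x `|f x|))%:E)%E.
  move=> mpsi psiC fi; have fn := integrable_norm fi.
  have mf : measurable_fun setT f by have /measurable_EFinP := measurable_int _ fi.
  rewrite mulrA EFinM /Rintegral fineK; last exact: integrable_fin_num.
  rewrite -integralZl//; apply: ge0_le_integral => //.
  - apply: measurableT_comp => //; apply/measurable_EFinP.
    by apply: measurable_funM => //; exact: measurable_funM.
  - by apply: measurable_int; exact: (integrableZl _ _ fn).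
  - move=> x _; rewrite -EFinM abse_EFin lee_fin !normrM mulrA.
    by rewrite ler_wpM2r// ler_wpM2l.
transitivity (\int[leb]_y \int[leb]_x (h y * (phi (x + y) * g x))).
  apply: eq_Rintegral => y _.
  by rewrite (@RintegralZl _ _ _ leb setT (fun x => phi (x + y) * g x) (h y) measurableT
    (igy y)).
rewrite (@Rintegral_exchange _ _ _ _ _ _ _ (fun p : rV * rV => h p.1 * (phi (p.2 + p.1) * g p.2))
    (fun y : rV => `|h y| * (C * \int[leb]_x `|g x|)) sf sf) //; first last.
- move=> x /=; rewrite (_ : (fun y => _) = fun y : rV => (g x * (phi (x + y) * h y))%:E).
    by apply: iZ; exact: ihx.
  by apply/funext => y; congr EFin; ring.
- by move=> y /=; apply: iZ; exact: igy.
- move=> y /=; apply: (bound (fun x : rV => phi (x + y))) => //.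
  exact: (measurableT_comp mphi (@measurable_addr _ _ y)).
- have := integrableZr measurableT (C * \int[leb]_x `|g x|) (integrable_norm ih).
  by [].
- apply: measurable_funM; first exact: (measurableT_comp mh measurable_fst).
  apply: measurable_funM; last exact: (measurableT_comp mg measurable_snd).
  by under eq_fun do rewrite addrC; exact: (measurableT_comp mphi mD).
transitivity (\int[leb]_x \int[leb]_z (g x * (phi z * h (z - x)))).
  apply: eq_Rintegral => x _ /=.
  rewrite -(Rintegral_invariant (@measurable_addr R d x) (f := fun z => g x * (phi z * h (z - x)))).
  + by apply: eq_Rintegral => y _; rewrite addrK [y + x]addrC; ring.
  + exact: lebesgue_rV_translation.
  + exact: (iZ (fun z => phi z * h (z - x)) (g x) (ihz x)).
rewrite (@Rintegral_exchange _ _ _ _ _ _ _ (fun p : rV * rV => g p.1 * (phi p.2 * h (p.2 - p.1)))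
    (fun x : rV => `|g x| * (C * \int[leb]_y `|h y|)) sf sf) //; first last.
- move=> z /=; under eq_fun do rewrite mulrCA [g _ * _]mulrC.
  by apply: iZ; exact: integrable_convolution.
- by move=> x /=; apply: iZ; exact: ihz.
- move=> x /=.
  rewrite -(Rintegral_invariant (@measurable_addr R d (- x)) (f := fun y => `|h y|)).
  + exact: (bound phi (fun z : rV => h (z - x)) (g x) mphi phiC (hm x)).
  + exact: lebesgue_rV_translation.
  + exact: integrable_norm.
- have := integrableZr measurableT (C * \int[leb]_y `|h y|) (integrable_norm ig).
  by [].
- apply: measurable_funM; first exact: (measurableT_comp mg measurable_fst).
  apply: measurable_funM; first exact: (measurableT_comp mphi measurable_snd).
  have msw : measurable_fun setT (fun p : rV * rV => (p.2, p.1)).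
    by apply: measurable_fun_pair; [exact: measurable_snd|exact: measurable_fst].
  exact: (measurableT_comp mh (measurableT_comp mB msw)).
apply: eq_Rintegral => z _ /=; rewrite /convolution mulrC.
rewrite -RintegralZl//; last exact: integrable_convolution.
by apply: eq_Rintegral => x _; ring.
Qed.

End convolution.

(** * Measures with a square-integrable density *)

Section representation.
Context (R : realType) (d : nat).
Local Notation rV := 'rV[R]_d.
Local Notation leb := (lebesgue_rV R d).
Implicit Types (W w S : set rV) (f g h phi : rV -> R).

(** If [phi] is close to [f] in L^2, then the integral of [f^2], which is the
integral of [(f - phi) f], is small. *)
Lemma orthogonal_Cc_ae0 W f : open W -> bounded_set W ->
  measurable_fun setT f -> vanishes_off W f -> (sqnorm f < +oo)%E ->
  (forall phi, Cc W phi -> \int[leb]_x (f x * phi x) = 0) ->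
  {ae leb, forall x, f x = 0}.
Proof.
move=> oW bW mf Wf fL ort.
have sfin h : (sqnorm h < +oo)%E -> sqnorm h \is a fin_num.
  by move=> hL; rewrite ge0_fin_numE// sqnorm_ge0.
have sf0 : fine (sqnorm f) = 0.
  apply/eqP; rewrite eq_le fine_ge0 ?sqnorm_ge0// andbT.
  apply/ler_addgt0Pr => e e0; rewrite add0r.
  have e4 : 0 < e / 4 by rewrite divr_gt0.
  have [phi Wphi fphi] := Cc_dense_L2 oW bW mf Wf fL e4.
  have mphi := Cc_measurable Wphi; have [C phiC] := bounded_Cc Wphi.
  have mfp : measurable_fun setT (fun x => f x - phi x) by exact: measurable_funB.
  have fpL : (sqnorm (fun x => f x - phi x)%R < +oo)%E by rewrite (lt_trans fphi)// ltry.
  have iff' := integrable_sqnorm mfp mf fpL fL.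
  have sfE : fine (sqnorm f) = \int[leb]_x ((f x - phi x) * f x).
    have ifp : leb.-integrable setT (fun x => (f x * phi x)%:E).
      have := integrableB measurableT (integrable_sqnorm mf mf fL fL) iff'.
      by under eq_fun do rewrite -EFinB -mulrBl opprB addrC subrK mulrC.
    rewrite -[RHS]addr0 -(ort _ Wphi) -(RintegralD measurableT iff' ifp).
    by apply: eq_Rintegral => x _; rewrite expr2; ring.
  (* for [t = 2] the right-hand side contains only half of the square norm of
     [f], which can be absorbed on the left *)
  have := Rintegral_le_sqnorm (ltr0n R 2) mfp mf fpL fL.
  rewrite -sfE ger0_norm ?fine_ge0 ?sqnorm_ge0//.
  have : fine (sqnorm (fun x => f x - phi x)) <= e / 4.
    by rewrite -lee_fin fineK ?ltW// sfin.
  lra.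
have {}sf0 : sqnorm f = 0%E by rewrite -(fineK (sfin _ fL)) sf0.
have : ae_eq leb setT (fun x => (f x ^+ 2)%:E) (cst 0%E).
  apply/ae_eq_integral_abs => //; first exact: measurable_sqr.
  rewrite -[RHS]sf0; apply: eq_integral => x _.
  by rewrite gee0_abs// lee_fin sqr_ge0.
apply: filterS => x /(_ I) [] /eqP; by rewrite sqrf_eq0 => /eqP.
Qed.

Lemma L2_sqnorm w f : f \in Lp w 2%:E ->
  [/\ measurable_fun setT f, vanishes_off w f & (sqnorm f < +oo)%E].
Proof.
move=> /andP[fL /set_mem /= wf]; have i2 := Lfun2_integrable_sqr fL.
split => //; first by have /andP[/set_mem] := fL.
by have := integrable_lty measurableT i2.
Qed.

Lemma integrable_vanishes_off w f : open w -> bounded_set w ->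
  measurable_fun setT f -> vanishes_off w f -> (sqnorm f < +oo)%E ->
  leb.-integrable setT (EFin \o f).
Proof.
move=> ow bw mf wf fL; have mw : measurable w := open_measurable_rV ow.
have := integrable_sqnorm mf (measurable_indic mw) fL (sqnorm_indicW ow bw).
congr (leb.-integrable setT _); apply/funext => x /=; congr EFin; rewrite indicE.
have [wx|wx] := pselect (w x); first by rewrite mem_set// mulr1.
by rewrite wf// mul0r.
Qed.

Lemma integrable_L2 w f : open w -> bounded_set w -> f \in Lp w 2%:E ->
  leb.-integrable setT (EFin \o f).
Proof. by move=> ow bw /L2_sqnorm[]; exact: integrable_vanishes_off. Qed.

Lemma sqnorm_bounded w f (B : R) : open w -> bounded_set w ->
  measurable_fun setT f -> vanishes_off w f -> (forall x, `|f x| <= B) ->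
  (sqnorm f < +oo)%E.
Proof.
move=> ow bw mf wf fB; have mw : measurable w := open_measurable_rV ow.
apply: (@le_lt_trans _ _ ((B ^+ 2)%:E * sqnorm (\1_w : rV -> R))%E); last first.
  by rewrite lte_mul_pinfty ?lee_fin ?sqr_ge0//; exact: sqnorm_indicW.
have m1 := measurable_sqr (measurable_indic (R := R) mw).
have s1 x : (0 <= ((\1_w x : R) ^+ 2)%:E)%E by rewrite lee_fin sqr_ge0.
rewrite -ge0_integralZl ?lee_fin ?sqr_ge0//; apply: ge0_le_integral => //.
- by move=> x _; rewrite lee_fin sqr_ge0.
- exact: measurable_sqr.
- by apply: emeasurable_funM => //; exact: measurable_cst.
- move=> x _; rewrite -EFinM lee_fin indicE.
  have [wx|wx] := pselect (w x); last by rewrite wf// expr0n mulr_ge0 ?sqr_ge0.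
  rewrite mem_set// expr1n mulr1 -(real_normK (num_real (f x))).
  by rewrite lerXn2r ?nnegrE//; exact: le_trans (fB x).
Qed.

Lemma open_setsub w S : open w -> open (setsub w S).
Proof.
rewrite !openE => ow _ [x wx [y Sy <-]].
have /nbhs_ballP[e /= e0 ew] := ow _ wx.
apply/nbhs_ballP; exists e => //= z; rewrite -ball_normE /= => xyz.
exists (z + y); last by exists y => //; rewrite addrK.
by apply: ew; rewrite -ball_normE /= opprD addrA addrAC.
Qed.

Lemma bounded_setsub w S : bounded_set w -> bounded_set S -> bounded_set (setsub w S).
Proof.
move=> /bounded_setP[M wM] /bounded_setP[N SN]; apply/bounded_setP.
exists (M + N) => _ [x wx [y Sy <-]].
by rewrite (le_trans (ler_normB _ _))// lerD ?wM ?SN.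
Qed.

Lemma Cc_C0 w phi : Cc w phi -> phi \in C0pred w.
Proof.
by move=> wphi; apply/mem_set => e e0; exists phi => // x; rewrite subrr normr0 ltW.
Qed.

Lemma continuous_C0 w (phi : C0 w) : continuous phi.
Proof.
have /set_mem /= phiP := C0P phi.
apply: continuous_uniform_limit => e e0; have [g [cg _] phig] := phiP e e0.
by exists g.
Qed.

Lemma bounded_C0 w (phi : C0 w) : exists C, forall x, `|phi x| <= C.
Proof.
have /set_mem /= /(_ _ ltr01)[g /bounded_Cc[C gC] phig] := C0P phi.
exists (C + 1) => x; rewrite -(subrK (g x) (phi x)) (le_trans (ler_normD _ _))//.
by rewrite addrC lerD.
Qed.

Definition L2_represented w (mu : M w) (h : rV -> R) :=
  h \in Lp w 2%:E /\ forall phi : C0 w, mu phi = \int[leb]_x (h x * phi x).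

Lemma L2_represented0 w : L2_represented (0 : M w) 0.
Proof.
split; first exact: rpred0.
move=> phi; transitivity (\int[leb]_x (0 : R)).
  by rewrite Rintegral_cst// mul0r.
by apply: eq_Rintegral => x _; exact/esym/mul0r.
Qed.

Lemma L2_representedD w (mu nu : M w) h k : open w -> bounded_set w ->
  L2_represented mu h -> L2_represented nu k -> L2_represented (mu + nu) (h + k).
Proof.
move=> ow bw [hL muh] [kL nuk]; split; first exact: rpredD.
move=> phi; change (mu phi + nu phi = \int[leb]_x ((h x + k x) * phi x)).
have [C phiC] := bounded_C0 phi.
have mphi := continuous_measurable_rV (@continuous_C0 w phi).
have int f : f \in Lp w 2%:E -> leb.-integrable setT (fun x => (f x * phi x)%:E).
  move=> fL; under eq_fun do rewrite mulrC.
  exact: (integrable_bounded_mul mphi phiC (integrable_L2 ow bw fL)).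
rewrite muh nuk -(RintegralD measurableT (int _ hL) (int _ kL)).
by apply: eq_Rintegral => x _; rewrite mulrDl.
Qed.

(** The density is [f] or [0] according to whether [insubd] returns its argument or
its default value. *)
Lemma L2_represented_M_of_fun w f : f \in Lp w 2%:E ->
  exists h, L2_represented (M_of_fun w f) h.
Proof.
move=> fL; rewrite /M_of_fun /insubd; case: insubP => [mu _ muE|_] /=; last first.
  by exists 0; exact: L2_represented0.
exists f; split => // phi; have [_ wf _] := L2_sqnorm fL.
rewrite -[M_fun mu]/(val mu) muE; apply: Rintegral_vanishes_off => x wx.
by rewrite wf// mul0r.
Qed.

(** Membership for the exponent [2] is a clause of [is_conv]; the value chosen when
there is no such function is zero. *)
Lemma conv_L2 w S (mu : M (setsub w S)) (g : L2 S) : Defs.conv mu g \in Lp w 2%:E.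
Proof.
rewrite /Defs.conv; case: xgetP => [f _ [fL _]|_]; last exact: rpred0.
by apply: fL; rewrite ltr1n lexx.
Qed.

(** Both functions have the same pairings with test functions on [w], by
[convolution_adjoint]; their difference, cut off outside [w], is square-integrable
and orthogonal to [C_c(w)]. *)
Lemma is_conv_ae_convolution w S (mu : M (setsub w S)) (g : L2 S) f h :
  open w -> bounded_set w -> open S -> bounded_set S ->
  L2_represented mu h -> is_conv mu g f ->
  {ae leb, forall x, w x -> f x = convolution h g x}.
Proof.
move=> ow bw oS bS [hL muh] [fLp fmu].
have fL : f \in Lp w 2%:E by apply: fLp; rewrite ltr1n lexx.
have oV := open_setsub (S := S) ow; have bV := bounded_setsub bw bS.
have [mf wf fs] := L2_sqnorm fL; have [mh Vh hs] := L2_sqnorm hL.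
have [mg Sg gs] := L2_sqnorm (L2P g).
have ig := integrable_L2 oS bS (L2P g); have ih := integrable_L2 oV bV hL.
have ifL := integrable_L2 ow bw fL.
have mw : measurable w := open_measurable_rV ow.
set u := convolution h g.
have cu : continuous u := continuous_convolution oV bV mh Vh hs mg ig gs.
have mu_ := continuous_measurable_rV cu.
pose B := 1 * fine (sqnorm h) + 1^-1 * fine (sqnorm g).
have uB x : `|u x| <= B := le_convolution x ltr01 mh mg hs gs.
pose F x := f x + (-1) * (u x * \1_w x).
have mk : measurable_fun setT (fun x => (-1) * (u x * \1_w x)).
  by do 2 (apply: measurable_funM => //); exact: measurable_indic.
have ks : (sqnorm (fun x => (-1) * (u x * \1_w x))%R < +oo)%E.
  apply: (sqnorm_bounded ow bw mk (B := B)) => [x wx|x].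
    by rewrite indicE memNset// !mulr0.
  rewrite mulN1r normrN normrM (le_trans _ (uB x))// ler_piMr//.
  by rewrite indicE ger0_norm ?ler0n// lern1 leq_b1.
have : {ae leb, forall x, F x = 0}.
  apply: (@orthogonal_Cc_ae0 w) => //.
  - exact: measurable_funD.
  - by move=> x wx; rewrite /F wf// indicE memNset// !mulr0 addr0.
  - by apply: le_lt_trans (sqnormD mf mk) _; rewrite lte_add_pinfty// lte_mul_pinfty.
  - move=> phi wphi; have mphi := Cc_measurable wphi; have [C phiC] := bounded_Cc wphi.
    have wphi0 : vanishes_off w phi.
      by have [_ [K [_ Kw Kphi]]] := wphi; move=> x wx; apply: Kphi => /Kw.
    have iphi := integrable_vanishes_off ow bw mphi wphi0
      (sqnorm_bounded ow bw mphi wphi0 phiC).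
    have iuphi := integrable_bounded_mul mu_ uB iphi.
    have ifphi : leb.-integrable setT (fun x => (f x * phi x)%:E).
      by under eq_fun do rewrite mulrC; exact: (integrable_bounded_mul mphi phiC ifL).
    transitivity (\int[leb]_x (f x * phi x) - \int[leb]_x (u x * phi x)).
      rewrite -(RintegralB measurableT ifphi iuphi); apply: eq_Rintegral => x _.
      rewrite /F indicE; have [wx|wx] := pselect (w x).
        by rewrite mem_set// mulr1; ring.
      by rewrite wphi0// !mulr0 subr0.
    apply/eqP; rewrite subr_eq0; apply/eqP.
    rewrite -(convolution_adjoint mphi phiC ig ih gs hs).
    rewrite -(Rintegral_vanishes_off (W := w)); last by move=> x wx; rewrite wf// mul0r.
    rewrite (fmu _ wphi) muh; apply: eq_Rintegral => y _; congr (_ * _).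
    rewrite -[C0_fun _]/(val _) insubdK; first exact: correlationE.
    exact/Cc_C0/Cc_correlation.
apply: filterS => x Fx wx; apply/eqP; rewrite -subr_eq0.
by move: Fx; rewrite /F indicE mem_set// mulr1 mulN1r => ->.
Qed.

Lemma conv_ae_continuous w S (mu : M (setsub w S)) (g : L2 S) h :
  open w -> bounded_set w -> open S -> bounded_set S -> L2_represented mu h ->
  exists2 u, continuous u & {ae leb, forall x, w x -> Defs.conv mu g x = u x}.
Proof.
move=> ow bw oS bS muh; rewrite /Defs.conv; case: xgetP => [f _ fP|_]; last first.
  by exists (cst 0); [exact: cst_continuous|exact: aeW].
exists (convolution h g); last exact: is_conv_ae_convolution muh fP.
have [hL _] := muh; have [mh Vh hs] := L2_sqnorm hL.
have [mg Sg gs] := L2_sqnorm (L2P g).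
exact: (continuous_convolution (open_setsub ow) (bounded_setsub bw bS) mh Vh hs mg
  (integrable_L2 oS bS (L2P g)) gs).
Qed.

End representation.

(** * Functions of finite prior are continuous *)

Lemma Mnorm_ge0 (R : realType) (d : nat) (w : set 'rV[R]_d) (mu : M w) :
  (0 <= Mnorm mu)%E.
Proof.
apply: (@le_trans _ _ `|mu 0|%:E); first by rewrite lee_fin.
apply: ereal_sup_ubound; exists 0 => //=.
rewrite /supnorm [X in sup X](_ : _ = [set 0]) ?sup1//.
apply/seteqP; split => [_ [x _ <-]|_ ->]; first by rewrite /= normr0.
by exists 0 => //; rewrite normr0.
Qed.

Theorem proposition2p2 (R : realType) (d : nat) (Omega Sigma : set 'rV[R]_d)
  (hOmega : bounded_domain Omega) (hSigma : bounded_domain Sigma)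
  (h0 : Sigma 0)
  (L : nat) (hL : (2 <= L)%N) (N : nat -> nat)
  (E : edges L N) (hE : incoming_ok E)
  (Nc : nat) (Z : {linear Theta Sigma E -> 'rV[R]_Nc}) (hZ : bounded_param Z)
  (J : forall i : 'I_L.-1, M_layer Omega Sigma N i.+1 -> \bar R)
  (J_ge0 : forall i mu, (0 <= J i mu)%E)
  (J_lsc : forall i, weakstar_lsc (J i))
  (J_0 : forall i, J i (fun=> 0) = 0%E)
  (J_L2 : forall i mu, (J i mu < +oo)%E ->
    forall n, exists2 f, f \in Lp (layer Omega Sigma i.+1) 2%:E &
      mu n = M_of_fun (layer Omega Sigma i.+1) f)
  (q : R) (hq : 1 < q <= 2)
  (v : 'rV[R]_d -> R) (hv : v \in Lp Omega q%:E)
  (hG : (gen_prior Z J v < +oo)%E) :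
  exists u : 'rV[R]_d -> R,
    {within closure Omega, continuous u} /\
    {ae lebesgue_rV R d, forall x, Omega x -> v x = u x}.
Proof.
have [bO oO _] := hOmega; have [bS oS _] := hSigma.
have [_ [[mu theta] [/= vconv _ _] <-] Gfin] := ereal_inf_lt hG.
have L1 : (0 < L.-1)%N by rewrite -ltnS prednK// ltnW.
pose i0 : 'I_L.-1 := Ordinal L1.
have Jfin : (J i0 (residual mu theta (i := i0)) < +oo)%E.
  apply: le_lt_trans Gfin; rewrite /energy (bigD1 i0)//= addeCA.
  rewrite leeDl// adde_ge0//; apply: sume_ge0 => // l _.
  by apply: sume_ge0 => n _; exact: Mnorm_ge0.
(* the first layer is the residual plus the image of the second layer *)
pose O1 := layer Omega Sigma i0.+1.
have oO1 : open O1 by exact: open_setsub.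
have bO1 : bounded_set O1 by exact: bounded_setsub.
have rep n : exists h, L2_represented (mu (lower i0) n) h.
  have [f fL resE] := J_L2 _ _ Jfin n.
  set c := conv_layer (l := upper i0) (mu (upper i0)) theta n.
  have cL : c \in Lp O1 2%:E by apply: rpred_sum => e _; exact: conv_L2.
  have [h hP] := L2_represented_M_of_fun fL.
  have [k kP] := L2_represented_M_of_fun cL.
  exists (h + k).
  have -> : mu (lower i0) n = M_of_fun O1 f + M_of_fun O1 c.
    by rewrite -resE /residual subrK.
  exact: L2_representedD.
have := vconv (lower i0) ord0 erefl.
set c := conv_layer _ _ _.
have [u cu cE] : exists2 u, continuous u &
    {ae lebesgue_rV R d, forall x, Omega x -> c x = u x}.
  apply: (big_ind (fun c => exists2 u, continuous u &
    {ae lebesgue_rV R d, forall x, Omega x -> c x = u x})).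
  - by exists (cst 0); [exact: cst_continuous|exact: aeW].
  - move=> c1 c2 [u1 cu1 c1E] [u2 cu2 c2E]; exists (fun x => u1 x + u2 x).
      by move=> x; exact: cvgD (cu1 x) (cu2 x).
    apply: filterS2 c1E c2E => x c1E c2E Ox.
    by change (c1 x + c2 x = u1 x + u2 x); rewrite c1E// c2E.
  - move=> e _; have [h hP] := rep (val e).1.
    exact: conv_ae_continuous hP.
move=> vE; exists u; split; first exact: continuous_subspaceT.
by apply: filterS2 vE cE => x vE cE Ox; rewrite vE// cE.
Qed.
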